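(* There exists a constant $\delta_0>0$ such that the following holds. Assume $\|\mathcal T-\mathcal S\|_{\mathrm{op}}\le\delta_0$. Then for Lebesgue-almost every initial point $x_0^+\in\mathbb R^{2n}$ there exists $\bar\alpha>0$ such that for any step sizes $(\alpha_k)_{k\in\mathbb N}$ with $\alpha_k\in(0,\bar\alpha]$ for all $k$ and $\sum_{k=0}^\infty\alpha_k=\infty$, the gradient descent iterates $x^+_{k+1}=x^+_k-\alpha_k\nabla f(x^+_k)$ converge to a global minimizer of $f$.
   Context: Let $n,m\ge 1$, $a_1,\dots,a_m\in\mathbb C^n$ and $x^\natural\in\mathbb C^n$. For $a,b\in\mathbb C^n$ write $\langle a,b\rangle=\sum_{j}a_j\overline{b_j}$ and let $\|\cdot\|$ be the Euclidean norm. Let $y_i=|\langle a_i,x^\natural\rangle|^2$. For $v\in\mathbb C^n$ put $v^+=(\mathrm{Re}\,v,\mathrm{Im}\,v)\in\mathbb R^{2n}$ and $v^-=Mv^+=(-\mathrm{Im}\,v,\mathrm{Re}\,v)$, where $M=\begin{bmatrix}0&-I_n\\ I_n&0\end{bmatrix}$. The map $x\mapsto x^+$ identifies $\mathbb C^n$ with $\mathbb R^{2n}$, and $x$ and $x^+$ always correspond to each other. Define $f:\mathbb R^{2n}\to\mathbb R$ by $f(x^+)=\sum_{i=1}^m\big(|\langle a_i,x\rangle|^2-y_i\big)^2=\sum_{i=1}^m\big(\langle A_ix^+,x^+\rangle-y_i\big)^2$ with $A_i=a_i^+(a_i^+)^{T}+a_i^-(a_i^-)^{T}$; gradients are taken with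 respect to $x^+\in\mathbb R^{2n}$. Fix $\sigma>0$ (in the paper, $\sigma^2=\mathrm{Var}((a_i^+)_1)$ for random measurement vectors) and set $c=m\sigma^4$. Define the order-4 tensors on $\mathbb R^{2n}$: $\mathcal T=\frac1c\sum_{i=1}^m(a_i^+)^{\otimes 4}$ and $\mathcal S_{i_1i_2i_3i_4}=\mathbf 1_{i_1=i_2,\,i_3=i_4}+\mathbf 1_{i_1=i_3,\,i_2=i_4}+\mathbf 1_{i_1=i_4,\,i_2=i_3}$. The inner product of tensors is the sum of entrywise products, and $\|\mathcal R\|_{\mathrm{op}}=\sup\{\langle \mathcal R,u_1\otimes u_2\otimes u_3\otimes u_4\rangle:\ u_j\in\mathbb R^{2n},\ \|u_1\|\|u_2\|\|u_3\|\|u_4\|=1\}$. *)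

(* Defs.v *)
From Stdlib Require Import Reals.
From Coquelicot Require Import Coquelicot.
Open Scope R_scope.

(* Vectors of R^d / C^d are represented as functions nat -> R / nat -> C;
   only the coordinates 0..d-1 are meaningful. *)

Fixpoint sumR (d : nat) (f : nat -> R) : R :=
  match d with O => 0 | S d' => sumR d' f + f d' end.

Fixpoint prodR (d : nat) (f : nat -> R) : R :=
  match d with O => 1 | S d' => prodR d' f * f d' end.

Fixpoint sumC (d : nat) (f : nat -> C) : C :=
  match d with O => RtoC 0 | S d' => Cplus (sumC d' f) (f d') end.

Definition cinner (n : nat) (a b : nat -> C) : C :=
  sumC n (fun j => Cmult (a j) (Cconj (b j))).

Definition vplus (n : nat) (v : nat -> C) : nat -> R :=
  fun k => if Nat.ltb k n then Re (v k) else Im (v (k - n)%nat).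

Definition toC (n : nat) (xp : nat -> R) : nat -> C :=
  fun j => (xp j, xp (n + j)%nat).

Definition rinner (d : nat) (u v : nat -> R) : R := sumR d (fun j => u j * v j).
Definition rnorm (d : nat) (u : nat -> R) : R := sqrt (rinner d u u).

Definition yobs (n : nat) (a : nat -> nat -> C) (xnat : nat -> C) (i : nat) : R :=
  (Cmod (cinner n (a i) xnat)) ^ 2.

Definition floss (n m : nat) (a : nat -> nat -> C) (xnat : nat -> C)
  (xp : nat -> R) : R :=
  sumR m (fun i => ((Cmod (cinner n (a i) (toC n xp))) ^ 2 - yobs n a xnat i) ^ 2).

Definition grad (d : nat) (F : (nat -> R) -> R) (x : nat -> R) : nat -> R :=
  fun k => if Nat.ltb k d then
             Derive (fun t => F (fun j => x j + t * (if Nat.eqb j k then 1 else 0))) 0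
           else 0.

Fixpoint gd (d : nat) (F : (nat -> R) -> R) (alpha : nat -> R) (x0 : nat -> R)
  (k : nat) : nat -> R :=
  match k with
  | O => x0
  | S k' => let xk := gd d F alpha x0 k' in
            fun j => xk j - alpha k' * grad d F xk j
  end.

Definition tensor := nat -> nat -> nat -> nat -> R.

Definition tinner (d : nat) (A B : tensor) : R :=
  sumR d (fun i1 => sumR d (fun i2 => sumR d (fun i3 => sumR d (fun i4 =>
    A i1 i2 i3 i4 * B i1 i2 i3 i4)))).

Definition outer4 (u1 u2 u3 u4 : nat -> R) : tensor :=
  fun i1 i2 i3 i4 => u1 i1 * u2 i2 * u3 i3 * u4 i4.

Definition ind (b : bool) : R := if b then 1 else 0.

Definition tensT (n m : nat) (a : nat -> nat -> C) (sigma : R) : tensor :=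
  fun i1 i2 i3 i4 =>
    / (INR m * sigma ^ 4) *
    sumR m (fun i => vplus n (a i) i1 * vplus n (a i) i2 * vplus n (a i) i3
                     * vplus n (a i) i4).

Definition tensS : tensor :=
  fun i1 i2 i3 i4 =>
    ind (Nat.eqb i1 i2 && Nat.eqb i3 i4) + ind (Nat.eqb i1 i3 && Nat.eqb i2 i4)
    + ind (Nat.eqb i1 i4 && Nat.eqb i2 i3).

Definition tsub (A B : tensor) : tensor := fun i1 i2 i3 i4 => A i1 i2 i3 i4 - B i1 i2 i3 i4.

Definition opnorm (d : nat) (A : tensor) : Rbar :=
  Lub_Rbar (fun r => exists u1 u2 u3 u4 : nat -> R,
    rnorm d u1 * rnorm d u2 * rnorm d u3 * rnorm d u4 = 1 /\
    r = tinner d A (outer4 u1 u2 u3 u4)).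

Definition lebesgue_null (d : nat) (E : (nat -> R) -> Prop) : Prop :=
  forall eps : R, 0 < eps ->
    exists lo hi : nat -> nat -> R,
      (forall k j, lo k j <= hi k j) /\
      (forall K, sumR K (fun k => prodR d (fun j => hi k j - lo k j)) <= eps) /\
      (forall x, E x -> exists k, forall j, (j < d)%nat -> lo k j <= x j <= hi k j).

(* Main.v *)
(* After normalising |z| = 1 for z = (x^nat)^+ and dividing by 16c, the gradient is
   a small Lipschitz perturbation of the ideal field obtained when T = S,
     (2q - 1) x - a z - b Mz,   q = |x|^2, a = <z,x>, b = <Mz,x>.
   Put p = a^2 + b^2.  Steps eventually bring q below 2.  From then on, if p > q/20 at
   some time, the ratio p/q grows up to 17/20, then q grows, and the iterate enters a
   neighbourhood of the circle of minimizers in which the distance to that circle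
   contracts.  Hence a bad starting point is one that, for arbitrarily small step
   sizes, has an orbit with p <= q/20 whenever q <= 2; such an orbit reaches q <= 3/5
   after a bounded amount of time.  For two such orbits the quadratic form
   V = |d_s|^2 - |d_w|^2 of their difference d, where s and w denote the components along
   span(z, Mz) and orthogonal to it, would grow forever if it were positive, so in the
   limit the set of end points is a 1-Lipschitz graph over w.  Since initial points are
   Lipschitz functions of the end points, bad points are covered by O(M^(d-1)) cubes of
   side O(1/M).  The gradient flow never has to be constructed: orbits with different
   step sizes are compared after grouping their steps into blocks of total length H. *)

Require Import Defs.
From Stdlib Require Import Reals Lra Lia PeanoNat ClassicalEpsilon Classical Cantor.
From Stdlib Require Import FunctionalExtensionality.
From Coquelicot Require Import Coquelicot.
Open Scope R_scope.

(** * Sums and inner products *)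

(** The exceptional set must be fixed before the step sizes, and there are uncountably many step
    sequences, so one null set per sequence would not do. A stable manifold theorem at the saddles
    is of little help: for [T = S] the critical points orthogonal to [z] and [Mz] are the origin and
    the whole sphere [q = 1/2] of that subspace, and how the perturbation deforms this sphere is
    unknown. The cone argument refers to no critical point; it compares two trapped orbits with each
    other, at any distance. For a nonzero signal, the tensor hypothesis reaches the dynamics only
    through [near_ideal]. Smallness of the perturbation could only place limits near the circle;
    that [g] vanishes exactly on it comes from the phase invariance of the measurements. A zero
    signal cannot be normalised and is treated apart. The quadratic form [V] bounds squared
    distances, with an error proportional to the block length [H]. Since cubes have side of order
    [1/M], blocks are taken of length of order [1/M^2]. *)

Lemma sumR_ext d f g : (forall i, (i < d)%nat -> f i = g i) -> sumR d f = sumR d g.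
Proof.
  induction d as [|d IH]; intros H; simpl; [easy|].
  rewrite IH by (intros; apply H; lia). now rewrite H by lia.
Qed.

Lemma sumR_plus d f g : sumR d (fun i => f i + g i) = sumR d f + sumR d g.
Proof. induction d as [|d IH]; simpl; [lra|rewrite IH; lra]. Qed.

Lemma sumR_scal d c f : sumR d (fun i => c * f i) = c * sumR d f.
Proof. induction d as [|d IH]; simpl; [lra|rewrite IH; lra]. Qed.

Lemma sumR_0 d : sumR d (fun _ => 0) = 0.
Proof. induction d as [|d IH]; simpl; lra. Qed.

Lemma sumR_le d f g : (forall i, (i < d)%nat -> f i <= g i) -> sumR d f <= sumR d g.
Proof.
  induction d as [|d IH]; intros H; simpl; [lra|].
  apply Rplus_le_compat; [apply IH; intros; apply H; lia|apply H; lia].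
Qed.

Lemma sumR_pos d f : (forall i, (i < d)%nat -> 0 <= f i) -> 0 <= sumR d f.
Proof. intros H. rewrite <- (sumR_0 d). now apply sumR_le. Qed.

Lemma sumR_term_le d f k :
  (k < d)%nat -> (forall i, (i < d)%nat -> 0 <= f i) -> f k <= sumR d f.
Proof.
  induction d as [|d IH]; intros Hk H; [lia|simpl].
  destruct (Nat.eq_dec k d) as [->|Hne].
  - pose proof (sumR_pos d f (fun i Hi => H i (Nat.lt_lt_succ_r _ _ Hi))); lra.
  - pose proof (H d (Nat.lt_succ_diag_r d)).
    assert (f k <= sumR d f) by (apply IH; [lia|intros; apply H; lia]). lra.
Qed.

Lemma sumR_app a b f : sumR (a + b) f = sumR a f + sumR b (fun j => f (a + j)%nat).
Proof.
  induction b as [|b IH]; simpl.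
  - rewrite Nat.add_0_r; lra.
  - rewrite Nat.add_succ_r; simpl; rewrite IH; lra.
Qed.

Lemma sumR_swap a b (f : nat -> nat -> R) :
  sumR a (fun i => sumR b (f i)) = sumR b (fun j => sumR a (fun i => f i j)).
Proof.
  induction a as [|a IH]; simpl.
  - now rewrite sumR_0.
  - now rewrite IH, sumR_plus.
Qed.

Lemma sumR_delta d k f :
  (k < d)%nat -> sumR d (fun j => Defs.ind (Nat.eqb k j) * f j) = f k.
Proof.
  induction d as [|d IH]; intros Hk; [lia|simpl].
  destruct (Nat.eq_dec k d) as [->|Hne].
  - rewrite (sumR_ext d _ (fun _ => 0)), sumR_0, Nat.eqb_refl.
    + unfold Defs.ind; lra.
    + intros i Hi. destruct (Nat.eqb_spec d i); [lia|unfold Defs.ind; lra].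
  - rewrite IH by lia. destruct (Nat.eqb_spec k d); [lia|unfold Defs.ind; lra].
Qed.

Lemma sumR_const d c : sumR d (fun _ => c) = INR d * c.
Proof. induction d as [|d IH]; [simpl; lra|]. cbn [sumR]. rewrite IH, S_INR. lra. Qed.

Lemma sumR_abs d f : Rabs (sumR d f) <= sumR d (fun i => Rabs (f i)).
Proof.
  induction d as [|d IH]; simpl; [rewrite Rabs_R0; lra|].
  eapply Rle_trans; [apply Rabs_triang|lra].
Qed.

Lemma is_lim_seq_sumR d (u : nat -> nat -> R) (l : nat -> R) :
  (forall j, (j < d)%nat -> is_lim_seq (fun k => u k j) (l j)) ->
  is_lim_seq (fun k => sumR d (u k)) (sumR d l).
Proof.
  induction d as [|d IH]; intros H; simpl.
  - apply is_lim_seq_const.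
  - apply (is_lim_seq_plus' (fun k => sumR d (u k)) (fun k => u k d)).
    + apply IH; intros; apply H; lia.
    + apply H; lia.
Qed.

Definition vadd (u v : nat -> R) : nat -> R := fun j => u j + v j.
Definition vsub (u v : nat -> R) : nat -> R := fun j => u j - v j.
Definition vscal (c : R) (u : nat -> R) : nat -> R := fun j => c * u j.

Lemma rinner_comm d u v : rinner d u v = rinner d v u.
Proof. apply sumR_ext; intros; ring. Qed.

Lemma rinner_addl d u v w : rinner d (vadd u v) w = rinner d u w + rinner d v w.
Proof. unfold rinner. rewrite <- sumR_plus. apply sumR_ext; intros; unfold vadd; ring. Qed.

Lemma rinner_scall d c u w : rinner d (vscal c u) w = c * rinner d u w.
Proof. unfold rinner. rewrite <- sumR_scal. apply sumR_ext; intros; unfold vscal; ring. Qed.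

Lemma rinner_subl d u v w : rinner d (vsub u v) w = rinner d u w - rinner d v w.
Proof.
  replace (rinner d u w - rinner d v w) with (rinner d u w + (-1) * rinner d v w) by ring.
  rewrite <- rinner_scall, <- rinner_addl.
  apply sumR_ext; intros; unfold vsub, vadd, vscal; ring.
Qed.

Lemma rinner_addr d u v w : rinner d w (vadd u v) = rinner d w u + rinner d w v.
Proof. rewrite !(rinner_comm d w). apply rinner_addl. Qed.

Lemma rinner_scalr d c u w : rinner d w (vscal c u) = c * rinner d w u.
Proof. rewrite !(rinner_comm d w). apply rinner_scall. Qed.

Lemma rinner_subr d u v w : rinner d w (vsub u v) = rinner d w u - rinner d w v.
Proof. rewrite !(rinner_comm d w). apply rinner_subl. Qed.

Lemma rinner_ext d u u' v v' :
  (forall j, (j < d)%nat -> u j = u' j) -> (forall j, (j < d)%nat -> v j = v' j) ->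
  rinner d u v = rinner d u' v'.
Proof. intros H H'. apply sumR_ext; intros. now rewrite H, H'. Qed.

Lemma rinner_pos d u : 0 <= rinner d u u.
Proof. apply sumR_pos; intros; nra. Qed.

Lemma rinner_sq_ge d u j : (j < d)%nat -> u j * u j <= rinner d u u.
Proof. intros Hj. apply (sumR_term_le d (fun j => u j * u j)); [easy|intros; nra]. Qed.

Lemma rinner_eq0 d u : rinner d u u = 0 -> forall j, (j < d)%nat -> u j = 0.
Proof. intros H j Hj. pose proof (rinner_sq_ge d u j Hj). nra. Qed.

Ltac vexp := repeat (rewrite ?rinner_addl, ?rinner_addr, ?rinner_subl, ?rinner_subr,
  ?rinner_scall, ?rinner_scalr).

Lemma rnorm_pos d u : 0 <= rnorm d u.
Proof. apply sqrt_pos. Qed.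

Lemma rnorm_sq d u : rnorm d u * rnorm d u = rinner d u u.
Proof. apply sqrt_sqrt, rinner_pos. Qed.

Lemma cauchy_schwarz_sq d u v :
  rinner d u v * rinner d u v <= rinner d u u * rinner d v v.
Proof.
  pose proof (rinner_pos d u) as Hu; pose proof (rinner_pos d v) as Hv.
  destruct (Req_dec (rinner d v v) 0) as [H0|H0].
  - assert (rinner d u v = 0) as ->; [|nra].
    unfold rinner. rewrite (sumR_ext d _ (fun _ => 0)), sumR_0; [easy|].
    intros i Hi. rewrite (rinner_eq0 d v H0 i Hi). ring.
  - pose proof (rinner_pos d (vsub (vscal (rinner d v v) u) (vscal (rinner d u v) v))) as H.
    revert H; vexp. rewrite (rinner_comm d v u). intros H. nra.
Qed.

Lemma Rabs_le_of_sq x y : 0 <= y -> x * x <= y * y -> Rabs x <= y.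
Proof. intros Hy H. apply Rabs_le. nra. Qed.

Lemma cauchy_schwarz d u v : Rabs (rinner d u v) <= rnorm d u * rnorm d v.
Proof.
  pose proof (rnorm_pos d u); pose proof (rnorm_pos d v).
  apply Rabs_le_of_sq; [nra|].
  replace (rnorm d u * rnorm d v * (rnorm d u * rnorm d v))
    with ((rnorm d u * rnorm d u) * (rnorm d v * rnorm d v)) by ring.
  rewrite !rnorm_sq. apply cauchy_schwarz_sq.
Qed.

Lemma cauchy_schwarz2 d u v :
  - (rnorm d u * rnorm d v) <= rinner d u v <= rnorm d u * rnorm d v.
Proof. pose proof (cauchy_schwarz d u v) as H. apply Rabs_le_between in H. lra. Qed.

Lemma rnorm_le_of_sq d u c : 0 <= c -> rinner d u u <= c * c -> rnorm d u <= c.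
Proof.
  intros Hc H. rewrite <- rnorm_sq in H. pose proof (rnorm_pos d u). nra.
Qed.

Lemma rnorm_triang d u v : rnorm d (vadd u v) <= rnorm d u + rnorm d v.
Proof.
  pose proof (rnorm_pos d u); pose proof (rnorm_pos d v).
  apply rnorm_le_of_sq; [lra|]. vexp. rewrite <- !rnorm_sq, (rinner_comm d v u).
  pose proof (cauchy_schwarz2 d u v). nra.
Qed.

Lemma rnorm_scal d c u : rnorm d (vscal c u) = Rabs c * rnorm d u.
Proof.
  unfold rnorm. vexp.
  replace (c * (c * rinner d u u)) with (Rsqr c * rinner d u u) by (unfold Rsqr; ring).
  rewrite sqrt_mult, sqrt_Rsqr_abs; [easy|apply Rle_0_sqr|apply rinner_pos].
Qed.

Lemma rnorm_ext d u v : (forall j, (j < d)%nat -> u j = v j) -> rnorm d u = rnorm d v.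
Proof. intros H. unfold rnorm. f_equal. now apply rinner_ext. Qed.

Lemma Rabs_m1 : Rabs (-1) = 1.
Proof. rewrite Rabs_left; lra. Qed.

Lemma rnorm_sub_comm d u v : rnorm d (vsub u v) = rnorm d (vsub v u).
Proof.
  rewrite (rnorm_ext d (vsub u v) (vscal (-1) (vsub v u))).
  - rewrite rnorm_scal, Rabs_m1; ring.
  - intros; unfold vsub, vscal; ring.
Qed.

Lemma rnorm_triang_sub d u v : rnorm d (vsub u v) <= rnorm d u + rnorm d v.
Proof.
  rewrite (rnorm_ext d (vsub u v) (vadd u (vscal (-1) v))).
  - eapply Rle_trans; [apply rnorm_triang|].
    rewrite rnorm_scal, Rabs_m1; lra.
  - intros; unfold vsub, vscal, vadd; ring.
Qed.

Lemma rnorm_coord d u j : (j < d)%nat -> Rabs (u j) <= rnorm d u.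
Proof.
  intros Hj. apply Rabs_le_of_sq; [apply rnorm_pos|].
  rewrite rnorm_sq. now apply rinner_sq_ge.
Qed.

(** Test the bound on [v = u]. The gradient is handled through its pairings with vectors, as a
    multilinear form, and this converts bounds on them into norm bounds. *)
Lemma rnorm_le_of_dual d u c :
  0 <= c -> (forall v, Rabs (rinner d u v) <= c * rnorm d v) -> rnorm d u <= c.
Proof.
  intros Hc H. specialize (H u). rewrite <- rnorm_sq in H.
  pose proof (rnorm_pos d u) as Hp.
  rewrite Rabs_pos_eq in H by nra.
  destruct (Rle_or_lt (rnorm d u) c) as [|Hlt]; [easy|nra].
Qed.

(** * One step of a nearly ideal field *)

Definition vzero : nat -> R := fun _ => 0.

Definition gstep (g : (nat -> R) -> nat -> R) (al : R) (x : nat -> R) : nat -> R :=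
  vsub x (vscal al (g x)).

Lemma rinner_zero d v : rinner d vzero v = 0.
Proof.
  unfold rinner. rewrite (sumR_ext d _ (fun _ => 0)), sumR_0; [easy|].
  intros; unfold vzero; ring.
Qed.

Lemma rnorm0_sub d u v : rnorm d v = 0 -> rnorm d (vsub u v) = rnorm d u.
Proof.
  intros H. apply rnorm_ext. intros j Hj. unfold vsub.
  rewrite (rinner_eq0 d v); [ring| |easy]. rewrite <- rnorm_sq, H; ring.
Qed.

(** Summing the increments gives [u k >= u 0 + c * sumR k al], which diverges. This forces an orbit
    out of a region when the only lower control on the steps is that their sum is infinite. *)
Lemma divergent_increments (u al : nat -> R) (c B : R) :
  0 < c -> is_lim_seq (fun K => sumR K al) p_infty ->
  (forall k, u k <= B) -> (forall k, u k + c * al k <= u (S k)) -> False.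
Proof.
  intros Hc Hal HB Hu.
  assert (Hs : forall k, u O + c * sumR k al <= u k).
  { induction k as [|k IH]; simpl; [lra|]. pose proof (Hu k); lra. }
  apply is_lim_seq_spec in Hal. destruct (Hal ((B - u O) / c)) as [N HN].
  specialize (HN N (Nat.le_refl N)). specialize (Hs N). specialize (HB N).
  apply Rlt_div_l in HN; [|easy]. lra.
Qed.

Lemma sumR_shift k0 K (al : nat -> R) :
  sumR K (fun i => al (k0 + i)%nat) = sumR (k0 + K) al - sumR k0 al.
Proof. rewrite sumR_app. ring. Qed.

Lemma divergent_shift k0 (al : nat -> R) :
  is_lim_seq (fun K => sumR K al) p_infty ->
  is_lim_seq (fun K => sumR K (fun i => al (k0 + i)%nat)) p_infty.
Proof.
  intros H. apply is_lim_seq_spec. intros M.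
  apply is_lim_seq_spec in H. destruct (H (M + sumR k0 al)) as [N HN].
  exists N. intros n Hn. rewrite sumR_shift. specialize (HN (k0 + n)%nat ltac:(lia)). lra.
Qed.

Section Dynamics.

Variable d : nat.
Variables z y : nat -> R.
Variable g : (nat -> R) -> nat -> R.

(* Here [y] plays the role of [Mz], and [g] that of the gradient divided by [16 c]. *)
Definition normsq x := rinner d x x.
Definition coord_z x := rinner d z x.
Definition coord_y x := rinner d y x.
Definition alignsq x := coord_z x * coord_z x + coord_y x * coord_y x.
Definition circ (a b : R) : nat -> R := vadd (vscal a z) (vscal b y).
(* The value of [g x] if [T = S]. *)
Definition drift x := vsub (vscal (2 * normsq x - 1) x) (circ (coord_z x) (coord_y x)).
Definition err x := vsub (g x) (drift x).

(** The factor [3 r^2 + 1] is the Lipschitz constant, on the ball of radius [r], of a cubic term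
    plus a linear one. Vanishing is expressed by norms because coordinates from [d] on carry no
    information. [ni_gcirc] does not follow from [ni_err]; it makes the circle consist of exact
    critical points. *)
Record near_ideal : Prop := {
  ni_zz : rinner d z z = 1;
  ni_yy : rinner d y y = 1;
  ni_zy : rinner d z y = 0;
  ni_err : forall r P Q, 0 <= r -> rnorm d P <= r -> rnorm d Q <= r ->
    rnorm d (vsub (err P) (err Q)) <= 1 / 1000 * (3 * (r * r) + 1) * rnorm d (vsub P Q);
  ni_lip : forall r P Q, 0 <= r -> rnorm d P <= r -> rnorm d Q <= r ->
    rnorm d (vsub (g P) (g Q)) <= 4 * (3 * (r * r) + 1) * rnorm d (vsub P Q);
  ni_g0 : rnorm d (g vzero) = 0;
  ni_gcirc : forall a b, a * a + b * b = 1 -> rnorm d (g (circ a b)) = 0 }.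

Hypothesis NI : near_ideal.

Let zz := ni_zz NI.
Let yy := ni_yy NI.
Let zy := ni_zy NI.

Lemma yz : rinner d y z = 0.
Proof. rewrite rinner_comm. apply zy. Qed.

Lemma normsq_pos x : 0 <= normsq x.
Proof. apply rinner_pos. Qed.

Lemma alignsq_pos x : 0 <= alignsq x.
Proof. unfold alignsq; nra. Qed.

Lemma circ_dist x a b :
  rinner d (vsub x (circ a b)) (vsub x (circ a b))
  = normsq x - 2 * (a * coord_z x + b * coord_y x) + (a * a + b * b).
Proof.
  unfold circ, normsq, coord_z, coord_y. vexp. rewrite (rinner_comm d x z), (rinner_comm d x y), zz, yy, zy, yz.
  ring.
Qed.

Lemma alignsq_le_normsq x : alignsq x <= normsq x.
Proof.
  pose proof (rinner_pos d (vsub x (circ (coord_z x) (coord_y x)))) as H.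
  rewrite circ_dist in H. unfold alignsq. lra.
Qed.

Lemma g_inner x v :
  rinner d (g x) v
  = (2 * normsq x - 1) * rinner d x v - coord_z x * rinner d z v - coord_y x * rinner d y v
    + rinner d (err x) v.
Proof. unfold err, drift, circ. vexp. ring. Qed.

Lemma rnorm_zero : rnorm d vzero = 0.
Proof. unfold rnorm. rewrite rinner_zero. apply sqrt_0. Qed.

Lemma err_null x : rnorm d (g x) = 0 -> rnorm d (drift x) = 0 -> rnorm d (err x) = 0.
Proof. intros H1 H2. unfold err. now rewrite rnorm0_sub. Qed.

Lemma drift_zero : rnorm d (drift vzero) = 0.
Proof.
  unfold rnorm, drift, circ, coord_z, coord_y. vexp.
  rewrite !rinner_zero, !(rinner_comm d _ vzero), !rinner_zero.
  replace (_ - _) with 0 by ring. apply sqrt_0.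
Qed.

Lemma circ_coord_z a b : coord_z (circ a b) = a.
Proof. unfold coord_z, circ. vexp. rewrite zz, zy. ring. Qed.

Lemma circ_coord_y a b : coord_y (circ a b) = b.
Proof. unfold coord_y, circ. vexp. rewrite yy, yz. ring. Qed.

Lemma circ_normsq a b : normsq (circ a b) = a * a + b * b.
Proof. unfold normsq, circ. vexp. rewrite zz, yy, zy, yz. ring. Qed.

Lemma drift_circ a b : a * a + b * b = 1 -> rnorm d (drift (circ a b)) = 0.
Proof.
  intros H. unfold drift. rewrite circ_coord_z, circ_coord_y, circ_normsq, H.
  rewrite (rnorm_ext d _ vzero).
  - apply rnorm_zero.
  - intros; unfold vsub, vscal, vzero; ring.
Qed.

Lemma rnorm_normsq x : rnorm d x * rnorm d x = normsq x.
Proof. apply rnorm_sq. Qed.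

Lemma vsub_zero x : rnorm d (vsub x vzero) = rnorm d x.
Proof. apply rnorm0_sub, rnorm_zero. Qed.

(** [err] vanishes at the origin, so its Lipschitz bound on the ball of radius [|x|] becomes a
    growth bound. *)
Lemma err_bound x : rnorm d (err x) <= 1 / 1000 * (3 * normsq x + 1) * rnorm d x.
Proof.
  pose proof (rnorm_pos d x) as Hx.
  pose proof (ni_err NI (rnorm d x) x vzero Hx (Rle_refl _)) as H.
  rewrite rnorm_zero, rnorm_normsq, vsub_zero, rnorm0_sub in H; [now apply H|].
  apply err_null; [apply (ni_g0 NI)|apply drift_zero].
Qed.

Lemma g_bound x : rnorm d (g x) <= 4 * (3 * normsq x + 1) * rnorm d x.
Proof.
  pose proof (rnorm_pos d x) as Hx.
  pose proof (ni_lip NI (rnorm d x) x vzero Hx (Rle_refl _)) as H.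
  rewrite rnorm_zero, rnorm_normsq, vsub_zero, rnorm0_sub in H; [now apply H|].
  apply (ni_g0 NI).
Qed.

Lemma g_bound_sq x : rinner d (g x) (g x) <= 16 * (3 * normsq x + 1) ^ 2 * normsq x.
Proof.
  pose proof (g_bound x) as H. pose proof (rnorm_pos d (g x)) as Hg.
  rewrite <- rnorm_sq, <- (rnorm_normsq x) in *.
  set (r := rnorm d x) in *. set (s := rnorm d (g x)) in *.
  apply Rle_trans with ((4 * (3 * (r * r) + 1) * r) * (4 * (3 * (r * r) + 1) * r)).
  - apply Rmult_le_compat; lra.
  - right; ring.
Qed.

Lemma err_inner_x x :
  - (1 / 1000 * (3 * normsq x + 1) * normsq x) <= rinner d (err x) x
    <= 1 / 1000 * (3 * normsq x + 1) * normsq x.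
Proof.
  pose proof (err_bound x) as H. pose proof (cauchy_schwarz2 d (err x) x) as Hc.
  pose proof (rnorm_pos d x).
  assert (rnorm d (err x) * rnorm d x <= 1 / 1000 * (3 * normsq x + 1) * normsq x); [|lra].
  rewrite <- (rnorm_normsq x) at 2. rewrite <- Rmult_assoc.
  now apply Rmult_le_compat_r.
Qed.

Lemma err_inner_circ x :
  rinner d (err x) (circ (coord_z x) (coord_y x)) <= 1 / 1000 * (3 * normsq x + 1) * normsq x.
Proof.
  pose proof (err_bound x) as H.
  pose proof (cauchy_schwarz2 d (err x) (circ (coord_z x) (coord_y x))) as Hc.
  assert (Hn : rnorm d (circ (coord_z x) (coord_y x)) <= rnorm d x).
  { apply rnorm_le_of_sq; [apply rnorm_pos|]. rewrite rnorm_normsq.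
    change (normsq (circ (coord_z x) (coord_y x)) <= normsq x). rewrite circ_normsq. apply alignsq_le_normsq. }
  pose proof (rnorm_pos d x). pose proof (rnorm_pos d (err x)).
  pose proof (rnorm_pos d (circ (coord_z x) (coord_y x))).
  eapply Rle_trans; [apply Hc|].
  rewrite <- (rnorm_normsq x) at 2. rewrite <- Rmult_assoc.
  now apply Rmult_le_compat.
Qed.

Lemma step_normsq al x :
  normsq (gstep g al x) = normsq x - 2 * al * rinner d (g x) x + al * al * rinner d (g x) (g x).
Proof.
  unfold normsq, gstep. vexp. rewrite (rinner_comm d x (g x)). ring.
Qed.

(** To first order [q] changes by [- 2 al <g x, x>], with ideal value [al (2 q + 2 p - 4 q^2)]. The
    term with [1 / 500] pays for [err]; the step restriction bounds the second order term
    [al^2 |g x|^2] by [al q / 100]. *)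
Lemma step_normsq_upper al x :
  0 <= al -> al * (16 * (3 * normsq x + 1) ^ 2) <= 1 / 100 ->
  normsq (gstep g al x) <= normsq x + al * (2 * normsq x + 2 * alignsq x - 4 * (normsq x * normsq x)
    + 1 / 500 * (3 * normsq x + 1) * normsq x + 1 / 100 * normsq x).
Proof.
  intros Hal Hs. rewrite step_normsq, g_inner.
  pose proof (g_bound_sq x) as Hg. pose proof (err_inner_x x) as He.
  pose proof (normsq_pos x) as Hq.
  change (rinner d x x) with (normsq x). change (rinner d z x) with (coord_z x).
  change (rinner d y x) with (coord_y x). unfold alignsq.
  set (G := rinner d (g x) (g x)) in *. set (e := rinner d (err x) x) in *.
  set (q := normsq x) in *. set (K := 16 * (3 * q + 1) ^ 2) in *.
  assert (al * al * G <= al * (1 / 100 * q)).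
  { rewrite Rmult_assoc. apply Rmult_le_compat_l; [easy|].
    apply Rle_trans with (al * (K * q)); [now apply Rmult_le_compat_l|].
    rewrite <- Rmult_assoc. now apply Rmult_le_compat_r. }
  assert (al * (- e) <= al * (1 / 1000 * (3 * q + 1) * q)) by
    (apply Rmult_le_compat_l; lra).
  nra.
Qed.

(** The second order term is nonnegative and is dropped, so steps of any size are allowed. *)
Lemma step_normsq_lower al x :
  0 <= al ->
  normsq x + al * (2 * normsq x + 2 * alignsq x - 4 * (normsq x * normsq x)
    - 1 / 500 * (3 * normsq x + 1) * normsq x) <= normsq (gstep g al x).
Proof.
  intros Hal. rewrite step_normsq, g_inner.
  pose proof (rinner_pos d (g x)) as Hg. pose proof (err_inner_x x) as He.
  pose proof (normsq_pos x) as Hq.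
  change (rinner d x x) with (normsq x). change (rinner d z x) with (coord_z x).
  change (rinner d y x) with (coord_y x). unfold alignsq.
  set (G := rinner d (g x) (g x)) in *. set (e := rinner d (err x) x) in *.
  set (q := normsq x) in *.
  assert (0 <= al * al * G) by (apply Rmult_le_pos; nra).
  assert (al * e <= al * (1 / 1000 * (3 * q + 1) * q)) by
    (apply Rmult_le_compat_l; lra).
  nra.
Qed.

(** The ideal field multiplies both coordinates by [2 q - 2], hence the first order change
    [(4 - 4 q) p]; the second order terms are squares and are dropped. *)
Lemma step_alignsq_lower al x :
  0 <= al ->
  alignsq x + al * ((4 - 4 * normsq x) * alignsq x - 1 / 500 * (3 * normsq x + 1) * normsq x)
  <= alignsq (gstep g al x).
Proof.
  intros Hal. pose proof (err_inner_circ x) as He.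
  assert (Ha : coord_z (gstep g al x) = coord_z x - al * ((2 * normsq x - 2) * coord_z x + rinner d (err x) z)).
  { unfold gstep. unfold coord_z at 1. vexp. rewrite (rinner_comm d z (g x)), g_inner, zz, yz.
    rewrite (rinner_comm d x z). unfold coord_z. ring. }
  assert (Hb : coord_y (gstep g al x) = coord_y x - al * ((2 * normsq x - 2) * coord_y x + rinner d (err x) y)).
  { unfold gstep. unfold coord_y at 1. vexp. rewrite (rinner_comm d y (g x)), g_inner, yy, zy.
    rewrite (rinner_comm d x y). unfold coord_y. ring. }
  unfold alignsq at 3. rewrite Ha, Hb. unfold circ in He. revert He. vexp. intros He.
  set (e1 := rinner d (err x) z) in *. set (e2 := rinner d (err x) y) in *.
  unfold alignsq. set (a := coord_z x) in *. set (b := coord_y x) in *. set (q := normsq x) in *.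
  assert (al * (a * e1 + b * e2) <= al * (1 / 1000 * (3 * q + 1) * q))
    by now apply Rmult_le_compat_l.
  assert (0 <= (al * ((2 * q - 2) * a + e1)) * (al * ((2 * q - 2) * a + e1)))
    by apply Rle_0_sqr.
  assert (0 <= (al * ((2 * q - 2) * b + e2)) * (al * ((2 * q - 2) * b + e2)))
    by apply Rle_0_sqr.
  nra.
Qed.

End Dynamics.

(** [R2] bounds the squared norm, and [16 (3 R2 + 1)^2] then bounds [|g x|^2 / |x|^2], by
    [g_bound_sq]. *)
Definition small_step (R2 al : R) : Prop :=
  0 < al /\ al * (16 * (3 * R2 + 1) ^ 2) <= 1 / 100.

Lemma small_step_mono R2 R2' al : 0 <= R2' <= R2 -> small_step R2 al -> small_step R2' al.
Proof.
  intros HR [H1 H2]. split; [easy|].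
  apply Rle_trans with (2 := H2). apply Rmult_le_compat_l; [lra|]. nra.
Qed.

Lemma small_step_2 al : small_step 2 al -> 0 < al <= 1 / 78400.
Proof. intros [H1 H2]. lra. Qed.

(** * Trapping regions and contraction towards the circle *)

Section Orbit.

Variable d : nat.
Variables z y : nat -> R.
Variable g : (nat -> R) -> nat -> R.
Hypothesis NI : near_ideal d z y g.

Notation q := (normsq d).
Notation a := (coord_z d z).
Notation b := (coord_y d y).
Notation p := (alignsq d z y).

Lemma step_up R2 al x :
  q x <= R2 -> small_step R2 al ->
  q (gstep g al x) <= q x + al * (2 * q x + 2 * p x - 4 * (q x * q x)
    + 1 / 500 * (3 * q x + 1) * q x + 1 / 100 * q x).
Proof.
  intros Hq Hal. pose proof (normsq_pos d x).
  destruct (small_step_mono R2 (q x) al ltac:(lra) Hal) as [H1 H2].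
  apply (step_normsq_upper _ _ _ _ NI); [lra|easy].
Qed.

Lemma step_far R2 al x :
  2 <= q x <= R2 -> small_step R2 al -> q (gstep g al x) <= q x - al.
Proof.
  intros Hq Hal. pose proof (step_up R2 al x (proj2 Hq) Hal) as H.
  pose proof (alignsq_le_normsq _ _ _ _ NI x) as Hp. destruct Hal as [Hal _].
  set (Q := q x) in *. set (P := p x) in *.
  assert (2 * Q + 2 * P - 4 * (Q * Q) + 1 / 500 * (3 * Q + 1) * Q + 1 / 100 * Q <= -1) by nra.
  nra.
Qed.

(** The first order increment is at most [4 (2 - q)] and [4 al <= 1], so a step cannot jump over the
    level [2]. The same device guards the level [3 / 5] in [step_stuck]. *)
Lemma step_near al x :
  q x <= 2 -> small_step 2 al -> q (gstep g al x) <= 2.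
Proof.
  intros Hq Hal. pose proof (step_up 2 al x Hq Hal) as H.
  pose proof (alignsq_le_normsq _ _ _ _ NI x) as Hp. pose proof (normsq_pos d x) as H0.
  apply small_step_2 in Hal. set (Q := q x) in *. set (P := p x) in *.
  assert (2 * Q + 2 * P - 4 * (Q * Q) + 1 / 500 * (3 * Q + 1) * Q + 1 / 100 * Q
    <= 4 * (2 - Q)) by nra.
  nra.
Qed.

(** For [p <= q / 20] the ideal rate is at most [q (21 / 10 - 4 q)], negative above [q = 21 / 40].
    The level [3 / 5] leaves room for the error terms. *)
Lemma step_stuck al x :
  q x <= 2 -> small_step 2 al -> p x <= q x / 20 ->
  (3 / 5 <= q x -> q (gstep g al x) <= q x - 1 / 20 * al) /\
  (q x <= 3 / 5 -> q (gstep g al x) <= 3 / 5).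
Proof.
  intros Hq Hal Hp. pose proof (step_up 2 al x Hq Hal) as H.
  pose proof (normsq_pos d x) as H0.
  apply small_step_2 in Hal. set (Q := q x) in *. set (P := p x) in *. split; intros H1.
  - assert (2 * Q + 2 * P - 4 * (Q * Q) + 1 / 500 * (3 * Q + 1) * Q + 1 / 100 * Q
      <= -1 / 20) by nra. nra.
  - assert (2 * Q + 2 * P - 4 * (Q * Q) + 1 / 500 * (3 * Q + 1) * Q + 1 / 100 * Q
      <= 4 * (3 / 5 - Q)) by nra. nra.
Qed.

(** For [q <= 2] the error factor [1 / 500 * (3 q + 1)] is at most [14 / 1000]. Positivity is
    propagated so that the ratio [p / q] keeps a meaning along the orbit. *)
Lemma step_low al x :
  0 < q x <= 2 -> small_step 2 al ->
  q x + al * (2 * q x + 2 * p x - 4 * (q x * q x) - 14 / 1000 * q x) <= q (gstep g al x)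
  /\ 0 < q (gstep g al x).
Proof.
  intros Hq Hal. apply small_step_2 in Hal.
  pose proof (step_normsq_lower _ _ _ _ NI al x ltac:(lra)) as H.
  pose proof (alignsq_pos d z y x) as Hp. set (Q := q x) in *. set (P := p x) in *.
  assert (2 * Q + 2 * P - 4 * (Q * Q) - 14 / 1000 * Q <=
    2 * Q + 2 * P - 4 * (Q * Q) - 1 / 500 * (3 * Q + 1) * Q) by nra.
  assert (- 7 * Q <= 2 * Q + 2 * P - 4 * (Q * Q) - 14 / 1000 * Q) by nra.
  split; nra.
Qed.

(** In the ideal flow [p] grows at relative rate [4 - 4 q] and [q] at relative rate [2 + 2 t - 4 q],
    where [t = p / q]. So [t' = 2 t (1 - t)]: [q] cancels, and for [1 / 20 <= t <= 17 / 20] this is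
    at least [95 / 1000], which covers all errors and leaves [1 / 50]. The conclusion is multiplied
    out to avoid dividing by the new [q]. *)
Lemma step_theta al x :
  0 < q x <= 2 -> small_step 2 al -> q x / 20 <= p x -> p x <= 17 / 20 * q x ->
  (p x / q x + 1 / 50 * al) * q (gstep g al x) <= p (gstep g al x).
Proof.
  intros Hq Hal Hp1 Hp2.
  pose proof (step_up 2 al x (proj2 Hq) Hal) as Hu.
  apply small_step_2 in Hal.
  pose proof (step_alignsq_lower _ _ _ _ NI al x ltac:(lra)) as Hl.
  set (Q := q x) in *. set (P := p x) in *. set (Q' := q (gstep g al x)) in *.
  apply Rle_trans with (2 := Hl).
  assert (HP : P = P / Q * Q) by (field; lra).
  set (t := P / Q) in *. rewrite HP in *.
  assert (Ht : 1 / 20 <= t <= 17 / 20) by nra.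
  assert (H1 : Q' <= Q + al * (Q * (2 + 2 * t - 4 * Q + 24 / 1000))).
  { eapply Rle_trans; [apply Hu|]. apply Rplus_le_compat_l, Rmult_le_compat_l; [lra|]. nra. }
  apply Rle_trans with ((t + 1 / 50 * al) * (Q + al * (Q * (2 + 2 * t - 4 * Q + 24 / 1000)))).
  { apply Rmult_le_compat_l; [nra|easy]. }
  assert (H2 : 1 / 500 * (3 * Q + 1) * Q <= 14 / 1000 * Q) by nra.
  assert (H3 : (t + 1 / 50 * al) * (1 + al * (2 + 2 * t - 4 * Q + 24 / 1000))
     <= t + al * ((4 - 4 * Q) * t - 14 / 1000)).
  { assert (1 / 50 * al * (2 + 2 * t - 4 * Q + 24 / 1000) <= 1 / 1000) by nra.
    assert (t * (2 + 2 * t - 4 * Q + 24 / 1000) + 1 / 50 + 1 / 1000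
      <= (4 - 4 * Q) * t - 14 / 1000) by nra.
    nra. }
  nra.
Qed.

Lemma step_theta_keep al x :
  0 < q x <= 2 -> small_step 2 al -> 17 / 20 * q x <= p x ->
  17 / 20 * q (gstep g al x) <= p (gstep g al x).
Proof.
  intros Hq Hal Hp.
  pose proof (step_up 2 al x (proj2 Hq) Hal) as Hu.
  apply small_step_2 in Hal.
  pose proof (step_alignsq_lower _ _ _ _ NI al x ltac:(lra)) as Hl.
  pose proof (alignsq_le_normsq _ _ _ _ NI x) as Hpq.
  set (Q := q x) in *. set (P := p x) in *. set (Q' := q (gstep g al x)) in *.
  apply Rle_trans with (2 := Hl).
  assert (H1 : Q' <= Q + al * (2 * Q + 2 * P - 4 * (Q * Q) + 24 / 1000 * Q)).
  { eapply Rle_trans; [apply Hu|]. apply Rplus_le_compat_l, Rmult_le_compat_l; [lra|]. nra. }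
  assert (H2 : 1 / 500 * (3 * Q + 1) * Q <= 14 / 1000 * Q) by nra.
  set (t := P - 17 / 20 * Q) in *.
  assert (HP : P = t + 17 / 20 * Q) by (unfold t; ring).
  assert (0 <= t) by lra.
  (* At [t = 0] this is the growth of the ratio at the value [17 / 20]. The allowance [100 t] costs
     at most [100 al t <= t], the margin already present. *)
  assert (17 / 20 * (2 * Q + 2 * P - 4 * (Q * Q) + 24 / 1000 * Q)
    <= (4 - 4 * Q) * P - 14 / 1000 * Q + 100 * t) by (rewrite HP; nra).
  nra.
Qed.

(* Squared distance of [x] to the circle of the points [circ z y a0 b0] with [a0^2 + b0^2 = 1]. *)
Definition distsq x := q x + 1 - 2 * sqrt (p x).

(** By Cauchy-Schwarz in the plane, [a0 a + b0 b] is at most [sqrt p] for a unit vector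
    [(a0, b0)]. *)
Lemma distsq_le x a0 b0 :
  a0 * a0 + b0 * b0 = 1 -> distsq x <= rinner d (vsub x (circ z y a0 b0)) (vsub x (circ z y a0 b0)).
Proof.
  intros H. rewrite (circ_dist _ _ _ _ NI), H. unfold distsq.
  assert (a0 * a x + b0 * b x <= sqrt (p x)); [|lra].
  pose proof (sqrt_pos (p x)) as Hs. pose proof (sqrt_sqrt _ (alignsq_pos d z y x)) as Hss.
  unfold alignsq in Hss at 3. apply Rsqr_incr_0_var; [|easy]. unfold Rsqr.
  rewrite Hss.
  assert (0 <= (a0 * b x - b0 * a x) * (a0 * b x - b0 * a x)) by apply Rle_0_sqr.
  replace (a x * a x + b x * b x) with
   ((a x * a x + b x * b x) * (a0 * a0 + b0 * b0)) by (rewrite H; ring).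
  nra.
Qed.

(** [w] is the point of the circle nearest to [x], well defined because [distsq x <= 1 / 2] forces
    [sqrt p >= 1 / 4]. As [g w] vanishes and both points have norm at most [2], [|g x|] is at most
    [52 = 4 (3 * 4 + 1)] times [|x - w|], and the perturbation at most [13 / 1000] times it.
    Contraction comes from [<g x, x - w> >= 4 / 10 |x - w|^2], the new distance to the circle being
    estimated by the distance to the old [w]. *)
Lemma basin x :
  distsq x <= 1 / 2 ->
  exists w, distsq x = rinner d (vsub x w) (vsub x w) /\
    rnorm d (g x) <= 52 * rnorm d (vsub x w) /\
    forall al, small_step 2 al -> distsq (gstep g al x) <= distsq x * (1 - al / 2).
Proof.
  intros HU.
  pose proof (sqrt_pos (p x)) as Hs0. pose proof (sqrt_sqrt _ (alignsq_pos d z y x)) as Hss.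
  pose proof (alignsq_le_normsq _ _ _ _ NI x) as Hpq.
  pose proof (normsq_pos d x) as Hq0.
  unfold distsq in HU. set (s := sqrt (p x)) in *.
  assert (Hs : 0 < s) by lra.
  set (a0 := a x / s). set (b0 := b x / s).
  assert (H1 : a0 * a0 + b0 * b0 = 1).
  { unfold a0, b0. unfold alignsq in Hss.
    replace (a x / s * (a x / s) + b x / s * (b x / s)) with ((a x * a x + b x * b x) / (s * s))
      by (field; lra). rewrite Hss. field. rewrite <- Hss. nra. }
  assert (Hab : a0 * a x + b0 * b x = s).
  { unfold a0, b0. unfold alignsq in Hss.
    replace (a x / s * a x + b x / s * b x) with ((a x * a x + b x * b x) / s)
      by (field; lra). rewrite <- Hss. field. lra. }
  pose proof (circ_dist _ _ _ _ NI x a0 b0) as Hd. rewrite Hab, H1 in Hd.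
  assert (Hz : rinner d z (circ z y a0 b0) = a0) by apply (circ_coord_z _ _ _ _ NI).
  assert (Hy : rinner d y (circ z y a0 b0) = b0) by apply (circ_coord_y _ _ _ _ NI).
  assert (Hw : rnorm d (circ z y a0 b0) <= 2).
  { apply rnorm_le_of_sq; [lra|]. change (normsq d (circ z y a0 b0) <= 2 * 2).
    rewrite (circ_normsq _ _ _ _ NI). lra. }
  assert (Hxw : rinner d x (circ z y a0 b0) = s).
  { rewrite <- Hab. unfold circ, coord_z, coord_y. vexp. now rewrite (rinner_comm d x z), (rinner_comm d x y). }
  assert (Hx : rnorm d x <= 2).
  { apply rnorm_le_of_sq; [lra|]. change (q x <= 2 * 2). nra. }
  pose proof (ni_gcirc _ _ _ _ NI a0 b0 H1) as Hg0.
  pose proof (err_null _ _ _ _ _ Hg0 (drift_circ _ _ _ _ NI a0 b0 H1)) as He0.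
  pose proof (ni_lip _ _ _ _ NI 2 x (circ z y a0 b0) ltac:(lra) Hx Hw) as Hg.
  pose proof (ni_err _ _ _ _ NI 2 x (circ z y a0 b0) ltac:(lra) Hx Hw) as He.
  rewrite rnorm0_sub in Hg by easy. rewrite rnorm0_sub in He by easy.
  set (w := circ z y a0 b0) in *.
  assert (Hu : distsq x = rinner d (vsub x w) (vsub x w)) by (rewrite Hd; unfold distsq; fold s; ring).
  exists w. split; [easy|]. split; [lra|].
  intros al Hal. apply small_step_2 in Hal.
  apply Rle_trans with (1 := distsq_le (gstep g al x) a0 b0 H1). fold w.
  assert (Hgw : rinner d (g x) (vsub x w) >= 4 / 10 * distsq x).
  { rewrite rinner_subr, !(g_inner d z y g). rewrite Hxw, Hz, Hy.
    change (rinner d x x) with (q x). change (rinner d z x) with (a x).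
    change (rinner d y x) with (b x).
    pose proof (cauchy_schwarz2 d (err d z y g x) (vsub x w)) as Hc.
    rewrite rinner_subr in Hc.
    assert (rnorm d (err d z y g x) * rnorm d (vsub x w) <= 13 / 1000 * distsq x).
    { rewrite Hu, <- rnorm_sq, <- Rmult_assoc. apply Rmult_le_compat_r; [apply rnorm_pos|lra]. }
    assert (Hid : (2 * q x - 1) * q x - s * s - (2 * q x - 2) * s >= 1 / 2 * distsq x).
    (* With [U = distsq x] and [u = q - 1], the left-hand side is [U + 3/4 (u+U)^2 - U^2]. *)
    { unfold distsq. fold s. set (Q := q x) in *.
      replace ((2 * Q - 1) * Q - s * s - (2 * Q - 2) * s) with
       ((Q + 1 - 2 * s) + 3 / 4 * ((2 * Q - 2 * s) * (2 * Q - 2 * s)) - (Q + 1 - 2 * s) * (Q + 1 - 2 * s)) by field.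
      assert (0 <= (2 * Q - 2 * s) * (2 * Q - 2 * s)) by apply Rle_0_sqr.
      assert (0 <= Q + 1 - 2 * s) by (rewrite Hd in Hu; nra).
      nra. }
    rewrite Hss in Hid. unfold alignsq in Hid.
    assert (a x * a0 + b x * b0 = s) by lra. nra. }
  assert (Hgg : rinner d (g x) (g x) <= 2704 * distsq x).
  { rewrite Hu, <- !rnorm_sq. pose proof (rnorm_pos d (g x)).
    pose proof (rnorm_pos d (vsub x w)). nra. }
  assert (Hexp : rinner d (vsub (gstep g al x) w) (vsub (gstep g al x) w)
    = distsq x - 2 * al * rinner d (g x) (vsub x w) + al * al * rinner d (g x) (g x)).
  { rewrite Hu. unfold gstep. vexp.
    rewrite (rinner_comm d x (g x)), (rinner_comm d w (g x)), (rinner_comm d w x). ring. }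
  rewrite Hexp. assert (0 <= distsq x) by (rewrite Hu; apply rinner_pos).
  set (U := distsq x) in *. set (G := rinner d (g x) (vsub x w)) in *.
  set (GG := rinner d (g x) (g x)) in *.
  assert (al * al * GG <= al * (1 / 10 * U)).
  { rewrite Rmult_assoc. apply Rmult_le_compat_l; [lra|].
    apply Rle_trans with (al * (2704 * U)); [apply Rmult_le_compat_l; lra|]. nra. }
  assert (al * (4 / 10 * U) <= al * G) by (apply Rmult_le_compat_l; lra).
  nra.
Qed.

End Orbit.

(** * Orbits that converge to a minimizer *)

Section Orbits.

Variable d : nat.
Variables z y : nat -> R.
Variable g : (nat -> R) -> nat -> R.
Hypothesis NI : near_ideal d z y g.

Notation q := (normsq d).
Notation a := (coord_z d z).
Notation b := (coord_y d y).
Notation p := (alignsq d z y).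
Notation U := (distsq d z y).

Definition is_orbit (al : nat -> R) (x : nat -> nat -> R) : Prop :=
  forall k, x (S k) = gstep g (al k) (x k).

Lemma orbit_shift k0 al x :
  is_orbit al x -> is_orbit (fun i => al (k0 + i)%nat) (fun i => x (k0 + i)%nat).
Proof. intros H k. now rewrite Nat.add_succ_r. Qed.

(** Nothing is asked outside [q <= 2], where [q] decreases whatever the ratio [p / q] is. A single
    failure inside already forces convergence, by [unstuck_converges]. *)
Definition stuck (x : nat -> nat -> R) : Prop :=
  forall k, q (x k) <= 2 -> p (x k) <= q (x k) / 20.

Lemma orbit_bounded R2 al x :
  2 <= R2 -> is_orbit al x -> (forall k, small_step R2 (al k)) -> q (x O) <= R2 ->
  forall k, q (x k) <= R2.
Proof.
  intros HR Hx Hal H0 k. induction k as [|k IH]; [easy|]. rewrite Hx.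
  destruct (Rle_or_lt (q (x k)) 2) as [H|H].
  - apply Rle_trans with (2 := HR). apply (step_near _ _ _ _ NI); [easy|].
    apply small_step_mono with (2 := Hal k); lra.
  - pose proof (step_far _ _ _ _ NI R2 (al k) (x k) ltac:(lra) (Hal k)).
    destruct (Hal k) as [? _]. lra.
Qed.

(** [q] loses at least [1 / 20] per unit of step length until it is below [3 / 5], by [step_far]
    above [2] and [step_stuck] below. The bound sees the steps only through their sum, so it is
    uniform over step sequences. *)
Lemma stuck_time R2 al x :
  2 <= R2 -> is_orbit al x -> (forall k, small_step R2 (al k)) -> q (x O) <= R2 ->
  stuck x -> forall k, q (x k) <= Rmax (3 / 5) (R2 - 1 / 20 * sumR k al).
Proof.
  intros HR Hx Hal H0 Hs k.
  induction k as [|k IH]; [simpl; pose proof (Rmax_r (3 / 5) (R2 - 1 / 20 * 0)); lra|].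
  rewrite Hx. simpl sumR.
  pose proof (orbit_bounded R2 al x HR Hx Hal H0 k) as Hb.
  pose proof (Rmax_l (3 / 5) (R2 - 1 / 20 * (sumR k al + al k))) as Hl.
  pose proof (Rmax_r (3 / 5) (R2 - 1 / 20 * (sumR k al + al k))) as Hr.
  pose proof (proj1 (Hal k)) as Hpos.
  assert (Hc : q (gstep g (al k) (x k)) <= 3 / 5 \/
    (3 / 5 < q (x k) /\ q (gstep g (al k) (x k)) <= q (x k) - 1 / 20 * al k)).
  { destruct (Rle_or_lt (q (x k)) 2) as [H|H].
    - destruct (step_stuck _ _ _ _ NI (al k) (x k) H
        (small_step_mono R2 2 _ ltac:(lra) (Hal k)) (Hs k H)) as [H1 H2].
      destruct (Rle_or_lt (q (x k)) (3 / 5)); [left; now apply H2|right; split; [easy|apply H1; lra]].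
    - right. split; [lra|].
      pose proof (step_far _ _ _ _ NI R2 (al k) (x k) ltac:(lra) (Hal k)). lra. }
  destruct Hc as [Hc|[Hc1 Hc2]]; [lra|].
  unfold Rmax in IH. destruct (Rle_dec (3 / 5) (R2 - 1 / 20 * sumR k al)); lra.
Qed.

Lemma distsq_pos x : U x <= 1 / 2 -> 0 <= U x.
Proof.
  intros H. destruct (basin _ _ _ _ NI x H) as (w & -> & _). apply rinner_pos.
Qed.

(** The distance [rho] to the circle decreases, and divergence of the steps excludes a positive
    limit. The orbit has a limit, and does not merely approach the circle, because each move is
    dominated by a multiple of the decrease of [rho]. *)
Lemma converge_from_basin al x :
  is_orbit al x -> (forall k, small_step 2 (al k)) ->
  is_lim_seq (fun K => sumR K al) p_infty -> U (x O) <= 1 / 2 ->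
  exists a0 b0, a0 * a0 + b0 * b0 = 1 /\
    forall j, (j < d)%nat -> is_lim_seq (fun k => x k j) (circ z y a0 b0 j).
Proof.
  intros Hx Hal Hdiv H0.
  assert (HU : forall k, U (x k) <= 1 / 2).
  { induction k as [|k IH]; [easy|]. rewrite Hx.
    destruct (basin _ _ _ _ NI (x k) IH) as (w & _ & _ & Hb).
    pose proof (distsq_pos _ IH). pose proof (small_step_2 _ (Hal k)).
    pose proof (Hb _ (Hal k)). nra. }
  assert (HU0 : forall k, 0 <= U (x k)) by (intros; apply distsq_pos, HU).
  set (rho := fun k => sqrt (U (x k))).
  assert (Hr0 : forall k, 0 <= rho k) by (intros; apply sqrt_pos).
  assert (Hrr : forall k, rho k * rho k = U (x k)) by (intros; now apply sqrt_sqrt).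
  assert (Hstep : forall k, rho (S k) <= rho k * (1 - al k / 4) /\
     rnorm d (g (x k)) <= 52 * rho k).
  { intros k. destruct (basin _ _ _ _ NI (x k) (HU k)) as (w & Hw & Hg & Hb).
    pose proof (small_step_2 _ (Hal k)). specialize (Hb _ (Hal k)). rewrite <- Hx in Hb.
    pose proof (HU0 k). pose proof (Hr0 k). split.
    - apply Rsqr_incr_0_var; [|nra]. unfold Rsqr. rewrite Hrr.
      apply Rle_trans with (1 := Hb). rewrite <- Hrr. nra.
    - apply Rle_trans with (1 := Hg). apply Rmult_le_compat_l; [lra|].
      unfold rho. rewrite Hw. apply Rle_refl. }
  assert (Hdec : forall k, rho (S k) <= rho k).
  { intros k. destruct (Hstep k) as [H _]. pose proof (Hr0 k) as Hk0. destruct (Hal k) as [? _]. nra. }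
  destruct (ex_finite_lim_seq_decr rho 0 Hdec Hr0) as [l Hl].
  assert (Hll : l = 0).
  { assert (Hl0 : forall k, l <= rho k) by (apply (is_lim_seq_decr_compare rho l Hl Hdec)).
    assert (Hlpos : 0 <= l).
    { apply (is_lim_seq_le (fun _ => 0) rho 0 l); [easy|apply is_lim_seq_const|easy]. }
    destruct (Req_dec l 0) as [|Hne]; [easy|exfalso].
    apply (divergent_increments (fun k => - rho k) al (l / 4) 0); [lra|easy| |].
    - intros k. pose proof (Hr0 k). lra.
    - intros k. destruct (Hstep k) as [H _]. destruct (Hal k) as [? _].
      pose proof (Hl0 k). nra. }
  subst l.
  assert (Hlim : forall j, exists l : R, (j < d)%nat -> is_lim_seq (fun k => x k j) l).
  { intros j. destruct (Nat.lt_ge_cases j d) as [Hj|Hj]; [|exists 0; lia].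
    (* [|x (S k) - x k| <= 52 al k rho k <= 208 (rho k - rho (S k))]. *)
    destruct (ex_finite_lim_seq_decr (fun k => x k j + 208 * rho k) (-3)) as [l Hlj].
    - intros k. destruct (Hstep k) as [H1 H2]. rewrite Hx. unfold gstep, vsub, vscal.
      pose proof (rnorm_coord d (g (x k)) j Hj) as Hc. apply Rabs_le_between in Hc.
      destruct (Hal k) as [Ha _]. pose proof (Hr0 k). nra.
    - intros k. pose proof (rnorm_coord d (x k) j Hj) as Hc.
      apply Rabs_le_between in Hc. pose proof (Hr0 k).
      assert (rnorm d (x k) <= 3); [|lra].
      apply rnorm_le_of_sq; [lra|]. change (q (x k) <= 3 * 3).
      pose proof (HU k) as Hu. unfold distsq in Hu.
      pose proof (alignsq_le_normsq _ _ _ _ NI (x k)).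
      pose proof (sqrt_sqrt _ (alignsq_pos d z y (x k))). pose proof (sqrt_pos (p (x k))). nra.
    - exists l. intros _.
      apply (is_lim_seq_ext (fun k => (x k j + 208 * rho k) - 208 * rho k)); [intros; ring|].
      replace (Finite l) with (Finite (l - 208 * 0)) by (f_equal; ring).
      apply is_lim_seq_minus'; [easy|]. now apply (is_lim_seq_scal_l rho 208 0). }
  apply choice in Hlim. destruct Hlim as [xs Hxs].
  assert (Hq : is_lim_seq (fun k => q (x k)) (q xs)).
  { apply (is_lim_seq_sumR d (fun k j => x k j * x k j)). intros j Hj.
    apply is_lim_seq_mult'; now apply Hxs. }
  assert (Ha : is_lim_seq (fun k => a (x k)) (a xs)).
  { apply (is_lim_seq_sumR d (fun k j => z j * x k j)). intros j Hj.
    apply is_lim_seq_mult'; [apply is_lim_seq_const|now apply Hxs]. }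
  assert (Hb : is_lim_seq (fun k => b (x k)) (b xs)).
  { apply (is_lim_seq_sumR d (fun k j => y j * x k j)). intros j Hj.
    apply is_lim_seq_mult'; [apply is_lim_seq_const|now apply Hxs]. }
  assert (Hp : is_lim_seq (fun k => p (x k)) (p xs)).
  { apply is_lim_seq_plus'; now apply is_lim_seq_mult'. }
  assert (HUl : is_lim_seq (fun k => U (x k)) 0).
  { apply (is_lim_seq_ext (fun k => rho k * rho k)); [easy|].
    replace (Finite 0) with (Finite (0 * 0)) by (f_equal; ring). now apply is_lim_seq_mult'. }
  (* Passing to the limit in [(q + 1 - U)^2 = 4 p] avoids the square root. With [p <= q] the limit
     satisfies [(q - 1)^2 <= 0]. *)
  assert (He : (q xs + 1 - 0) * (q xs + 1 - 0) = 4 * p xs).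
  { assert (H1 : is_lim_seq (fun k => (q (x k) + 1 - U (x k)) * (q (x k) + 1 - U (x k)))
      ((q xs + 1 - 0) * (q xs + 1 - 0))).
    { assert (is_lim_seq (fun k => q (x k) + 1 - U (x k)) (q xs + 1 - 0)).
      { apply is_lim_seq_minus'; [|easy]. apply is_lim_seq_plus'; [easy|apply is_lim_seq_const]. }
      now apply is_lim_seq_mult'. }
    assert (H2 : is_lim_seq (fun k => 4 * p (x k)) (4 * p xs)).
    { apply is_lim_seq_mult'; [apply is_lim_seq_const|easy]. }
    apply is_lim_seq_ext with (v := fun k => 4 * p (x k)) in H1.
    - apply is_lim_seq_unique in H1, H2. rewrite H1 in H2. now injection H2.
    - intros k. unfold distsq.
      pose proof (sqrt_sqrt _ (alignsq_pos d z y (x k))). nra. }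
  pose proof (alignsq_le_normsq _ _ _ _ NI xs) as Hpq.
  assert (Hq1 : q xs = 1) by nra. assert (Hp1 : p xs = 1) by nra.
  exists (a xs), (b xs). split; [exact Hp1|].
  intros j Hj. replace (circ z y (a xs) (b xs) j) with (xs j); [now apply Hxs|].
  pose proof (circ_dist _ _ _ _ NI xs (a xs) (b xs)) as Hd.
  assert (Hz : rinner d (vsub xs (circ z y (a xs) (b xs))) (vsub xs (circ z y (a xs) (b xs))) = 0).
  { rewrite Hd. unfold alignsq in Hp1. lra. }
  pose proof (rinner_eq0 d _ Hz j Hj) as H. unfold vsub in H. lra.
Qed.

Lemma unstuck_converges al x k0 :
  is_orbit al x -> (forall k, small_step 2 (al k)) ->
  is_lim_seq (fun K => sumR K al) p_infty ->
  q (x k0) <= 2 -> q (x k0) / 20 < p (x k0) ->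
  exists a0 b0, a0 * a0 + b0 * b0 = 1 /\
    forall j, (j < d)%nat -> is_lim_seq (fun k => x k j) (circ z y a0 b0 j).
Proof.
  intros Hx Hal Hdiv Hq Hp.
  assert (Hshift : forall k1, U (x k1) <= 1 / 2 -> exists a0 b0, a0 * a0 + b0 * b0 = 1 /\
    forall j, (j < d)%nat -> is_lim_seq (fun k => x k j) (circ z y a0 b0 j)).
  { intros k1 Hk1.
    destruct (converge_from_basin (fun i => al (k1 + i)%nat) (fun i => x (k1 + i)%nat))
      as (a0 & b0 & H1 & H2).
    - now apply orbit_shift.
    - easy.
    - now apply divergent_shift.
    - now rewrite Nat.add_0_r.
    - exists a0, b0. split; [easy|]. intros j Hj.
      apply is_lim_seq_incr_n with (N := k1).
      apply (is_lim_seq_ext (fun k => x (k1 + k)%nat j)); [intros; now rewrite Nat.add_comm|].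
      now apply H2. }
  assert (Hq0 : 0 < q (x k0)).
  { pose proof (alignsq_le_normsq _ _ _ _ NI (x k0)). pose proof (alignsq_pos d z y (x k0)). lra. }
  assert (HA : exists k1, 0 < q (x k1) <= 2 /\ 17 / 20 * q (x k1) <= p (x k1)).
  { apply NNPP. intros Hn.
    assert (Hi : forall i, 0 < q (x (k0 + i)%nat) <= 2 /\
      q (x (k0 + i)%nat) / 20 <= p (x (k0 + i)%nat)).
    { induction i as [|i IH]; [rewrite Nat.add_0_r; lra|].
      rewrite Nat.add_succ_r, Hx.
      destruct (Rle_or_lt (17 / 20 * q (x (k0 + i)%nat)) (p (x (k0 + i)%nat))) as [H|H].
      { exfalso. apply Hn. exists (k0 + i)%nat. easy. }
      destruct IH as [IH1 IH2].
      pose proof (step_theta _ _ _ _ NI _ _ IH1 (Hal (k0 + i)%nat) IH2 (Rlt_le _ _ H)) as Ht.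
      pose proof (step_low _ _ _ _ NI _ _ IH1 (Hal (k0 + i)%nat)) as [_ Hl].
      pose proof (step_near _ _ _ _ NI _ _ (proj2 IH1) (Hal (k0 + i)%nat)) as Hu.
      split; [easy|]. apply Rle_trans with (2 := Ht).
      assert (1 / 20 <= p (x (k0 + i)%nat) / q (x (k0 + i)%nat))
        by (apply -> Rle_div_r; [lra|apply IH1]).
      destruct (Hal (k0 + i)%nat) as [? _]. nra. }
    apply (divergent_increments (fun i => p (x (k0 + i)%nat) / q (x (k0 + i)%nat))
      (fun i => al (k0 + i)%nat) (1 / 50) 1); [lra|now apply divergent_shift| |].
    - intros i. destruct (Hi i) as [H1 H2]. apply Rle_div_l; [easy|].
      pose proof (alignsq_le_normsq _ _ _ _ NI (x (k0 + i)%nat)). lra.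
    - intros i. destruct (Hi i) as [H1 H2]. destruct (Hi (S i)) as [H3 _].
      rewrite Nat.add_succ_r in *. apply Rle_div_r; [easy|]. rewrite Hx.
      apply (step_theta _ _ _ _ NI); [easy|easy|easy|].
      destruct (Rle_or_lt (p (x (k0 + i)%nat)) (17 / 20 * q (x (k0 + i)%nat))) as [H|H]; [easy|].
      exfalso. apply Hn. exists (k0 + i)%nat. split; [easy|lra]. }
  destruct HA as (k1 & Hq1 & Hp1).
  assert (Hi : forall i, 0 < q (x (k1 + i)%nat) <= 2 /\
      17 / 20 * q (x (k1 + i)%nat) <= p (x (k1 + i)%nat)).
  { induction i as [|i [IH1 IH2]]; [rewrite Nat.add_0_r; lra|].
    rewrite Nat.add_succ_r, Hx.
    pose proof (step_low _ _ _ _ NI _ _ IH1 (Hal (k1 + i)%nat)) as [_ Hl].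
    pose proof (step_near _ _ _ _ NI _ _ (proj2 IH1) (Hal (k1 + i)%nat)) as Hu.
    split; [easy|]. now apply (step_theta_keep _ _ _ _ NI). }
  assert (HB : exists i, 1 / 5 <= q (x (k1 + i)%nat)).
  { apply NNPP. intros Hn.
    assert (Hlt : forall i, q (x (k1 + i)%nat) < 1 / 5).
    { intros i. apply Rnot_le_lt. intros H. apply Hn. now exists i. }
    (* Below [q = 1 / 5] and with [p >= 17 / 20 q], the relative growth rate of [q] is at least
       [2 + 17 / 10 - 4 / 5 - 14 / 1000 > 1]. *)
    assert (Hup : forall i, q (x (k1 + i)%nat) + al (k1 + i)%nat * q (x (k1 + i)%nat)
        <= q (x (k1 + S i)%nat)).
    { intros i. destruct (Hi i) as [H1 H2].
      rewrite Nat.add_succ_r, Hx.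
      pose proof (step_low _ _ _ _ NI _ _ H1 (Hal (k1 + i)%nat)) as [Hl _].
      apply Rle_trans with (2 := Hl). apply Rplus_le_compat_l, Rmult_le_compat_l.
      - destruct (Hal (k1 + i)%nat) as [? _]; lra.
      - pose proof (Hlt i). nra. }
    assert (Hge : forall i, q (x k1) <= q (x (k1 + i)%nat)).
    { induction i as [|i IH]; [rewrite Nat.add_0_r; lra|].
      pose proof (Hup i). destruct (Hal (k1 + i)%nat) as [? _]. nra. }
    apply (divergent_increments (fun i => q (x (k1 + i)%nat))
      (fun i => al (k1 + i)%nat) (q (x k1)) 2); [easy|now apply divergent_shift| |].
    - intros i. apply (Hi i).
    - intros i. pose proof (Hup i). pose proof (Hge i). destruct (Hal (k1 + i)%nat) as [? _]. nra. }
  destruct HB as [i HBi]. destruct (Hi i) as [H1 H2].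
  apply (Hshift (k1 + i)%nat). unfold distsq. set (Q := q (x (k1 + i)%nat)) in *.
  (* This restates [U <= 1 / 2]. Given [p >= 17 / 20 q], it holds for all [1 / 5 <= q <= 2], which
     is why the ratio is first raised to [17 / 20]. *)
  assert ((Q + 1 / 2) / 2 <= sqrt (p (x (k1 + i)%nat))); [|lra].
  rewrite <- (sqrt_Rsqr ((Q + 1 / 2) / 2)) by lra.
  apply sqrt_le_1_alt. unfold Rsqr. nra.
Qed.

End Orbits.

(** * Stuck orbits and the cone argument *)

(** The shortest block whose sum exceeds [H] overshoots by at most its last step. *)
Lemma divergent_block (al : nat -> R) (eta H : R) (k : nat) :
  (forall i, 0 < al i <= eta) -> is_lim_seq (fun K => sumR K al) p_infty -> 0 < H ->
  exists n, H <= sumR n (fun i => al (k + i)%nat) <= H + eta.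
Proof.
  intros Hal Hdiv HH. apply (divergent_shift k) in Hdiv.
  apply is_lim_seq_spec in Hdiv. destruct (Hdiv H) as [N HN].
  specialize (HN N (Nat.le_refl N)). clear Hdiv. induction N as [|N IH].
  - simpl in HN. lra.
  - destruct (Rlt_or_le H (sumR N (fun i => al (k + i)%nat))) as [Hl|Hl]; [now apply IH|].
    exists (S N). simpl in *. pose proof (Hal (k + N)%nat). lra.
Qed.

Lemma pow_le_exp x n : 0 <= x -> (1 + x) ^ n <= exp (INR n * x).
Proof.
  intros Hx. induction n as [|n IH]; [simpl; rewrite Rmult_0_l, exp_0; lra|].
  rewrite S_INR, Rmult_plus_distr_r, Rmult_1_l, exp_plus, (Rmult_comm (exp _)). cbn [pow].
  apply Rmult_le_compat; [lra|apply pow_le; lra|apply exp_ineq1_le|easy].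
Qed.

(** * Comparison of orbits on a common time grid *)

Section Approximation.

Variable d : nat.
Variable g : (nat -> R) -> nat -> R.

(** Along a block of total length [T] the point moves by at most [T G], so [g] changes by at most
    [L T G]. However it is divided, the block is one Euler step of length [T] up to second order. *)
Lemma block_displacement (al : nat -> R) (x : nat -> nat -> R) (L G : R) (k n : nat) :
  0 <= L -> 0 <= G -> (forall i, 0 < al i) -> is_orbit g al x ->
  (forall i, rnorm d (g (x i)) <= G) ->
  (forall i j, rnorm d (vsub (g (x i)) (g (x j))) <= L * rnorm d (vsub (x i) (x j))) ->
  let T := sumR n (fun i => al (k + i)%nat) in
  0 <= T /\ rnorm d (vsub (x (k + n)%nat) (x k)) <= T * G /\
  rnorm d (vadd (vsub (x (k + n)%nat) (x k)) (vscal T (g (x k)))) <= L * G * (T * T).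
Proof.
  intros HL HG Hal Hx Hg Hlip. induction n as [|n IH]; intros T.
  - unfold T; simpl. rewrite Nat.add_0_r.
    assert (H0 : rnorm d (vsub (x k) (x k)) = 0).
    { rewrite (rnorm_ext d _ vzero), rnorm_zero; [easy|]. intros; unfold vsub, vzero; ring. }
    split; [lra|]. split; [lra|].
    rewrite (rnorm_ext d _ vzero), rnorm_zero; [lra|].
    intros; unfold vadd, vsub, vscal, vzero; ring.
  - cbv zeta in IH. set (S0 := sumR n (fun i => al (k + i)%nat)) in *.
    assert (HS : T = S0 + al (k + n)%nat) by reflexivity.
    destruct IH as (H1 & H2 & H3). pose proof (Hal (k + n)%nat) as Ha.
    rewrite Nat.add_succ_r, Hx. set (A := al (k + n)%nat) in *. set (X := x (k + n)%nat) in *.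
    split; [lra|]. split.
    + rewrite (rnorm_ext d _ (vadd (vsub X (x k)) (vscal (- A) (g X)))).
      2:{ intros; unfold gstep, vadd, vsub, vscal; ring. }
      eapply Rle_trans; [apply rnorm_triang|]. rewrite rnorm_scal, Rabs_Ropp, Rabs_pos_eq by lra.
      pose proof (Hg (k + n)%nat) as Hgk. fold X in Hgk. nra.
    + rewrite (rnorm_ext d _ (vadd (vadd (vsub X (x k)) (vscal S0 (g (x k))))
        (vscal (- A) (vsub (g X) (g (x k)))))).
      2:{ intros; unfold gstep, vadd, vsub, vscal; rewrite HS; ring. }
      eapply Rle_trans; [apply rnorm_triang|]. rewrite rnorm_scal, Rabs_Ropp, Rabs_pos_eq by lra.
      pose proof (Hlip (k + n)%nat k) as Hl. fold X in Hl.
      assert (rnorm d (vsub (g X) (g (x k))) <= L * (S0 * G)).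
      { apply Rle_trans with (1 := Hl). now apply Rmult_le_compat_l. }
      assert (0 <= L * G) by nra. rewrite HS.
      assert (A * rnorm d (vsub (g X) (g (x k))) <= A * (L * (S0 * G)))
        by (apply Rmult_le_compat_l; lra).
      assert (0 <= L * G * (A * S0)) by (apply Rmult_le_pos; nra).
      assert (0 <= L * G * (A * A)) by (apply Rmult_le_pos; nra).
      nra.
Qed.

(* Orbits with different step sizes all yield sequences of this kind for the same [H],
   which can then be compared index by index. *)
Definition euler_like (C H : R) (P : nat -> nat -> R) : Prop :=
  forall j, rnorm d (vadd (vsub (P (S j)) (P j)) (vscal H (g (P j)))) <= C * (H * H).

(** Blocks have length between [H] and [H + H^2 <= 2 H], because [al <= H^2]. Freezing [g] over a
    block costs [4 L G H^2], and replacing its length by exactly [H] costs [G H^2]. *)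
Lemma subsampled_orbit (al : nat -> R) (x : nat -> nat -> R) (L G H : R) :
  0 <= L -> 0 <= G -> is_orbit g al x ->
  (forall i, rnorm d (g (x i)) <= G) ->
  (forall i j, rnorm d (vsub (g (x i)) (g (x j))) <= L * rnorm d (vsub (x i) (x j))) ->
  0 < H <= 1 -> (forall i, 0 < al i <= H * H) ->
  is_lim_seq (fun K => sumR K al) p_infty ->
  exists P, P O = x O /\ euler_like ((4 * L + 1) * G) H P /\
    forall j, exists k, P j = x k /\ INR j * H <= sumR k al.
Proof.
  intros HL HG Hx Hg Hlip HH Hal Hdiv.
  assert (Hn : forall k, exists n, H <= sumR n (fun i => al (k + i)%nat) <= H + H * H).
  { intros k. now apply divergent_block. }
  apply choice in Hn. destruct Hn as [n Hn].
  set (idx := fun j => Nat.iter j (fun k => (k + n k)%nat) O).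
  exists (fun j => x (idx j)). split; [easy|]. split.
  - intros j. change (idx (S j)) with (idx j + n (idx j))%nat. set (k := idx j).
    destruct (block_displacement al x L G k (n k) HL HG (fun i => proj1 (Hal i)) Hx Hg Hlip)
      as (_ & _ & H3).
    specialize (Hn k). set (S0 := sumR (n k) (fun i => al (k + i)%nat)) in *.
    rewrite (rnorm_ext d _ (vadd (vadd (vsub (x (k + n k)%nat) (x k)) (vscal S0 (g (x k))))
      (vscal (H - S0) (g (x k))))).
    2:{ intros; unfold vadd, vsub, vscal; ring. }
    eapply Rle_trans; [apply rnorm_triang|].
    rewrite rnorm_scal, Rabs_left1 by lra.
    assert ((- (H - S0)) * rnorm d (g (x k)) <= (H * H) * G).
    { apply Rmult_le_compat; [lra|apply rnorm_pos|lra|apply Hg]. }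
    assert (HHH : H * H <= H) by nra. assert (HS2 : 0 <= S0 <= 2 * H) by lra.
    assert (S0 * S0 <= 4 * (H * H)) by (clear -HS2; nra).
    assert (0 <= L * G) by nra.
    assert (L * G * (S0 * S0) <= L * G * (4 * (H * H))) by now apply Rmult_le_compat_l.
    nra.
  - intros j. exists (idx j). split; [easy|].
    induction j as [|j IH]; [simpl; lra|].
    change (idx (S j)) with (idx j + n (idx j))%nat. rewrite sumR_app, S_INR.
    specialize (Hn (idx j)). lra.
Qed.

(** A Gronwall estimate backwards in time: up to [O(H)], initial points depend in a Lipschitz way on
    the points at index [J], with a factor governed by [L] and the elapsed time [J H]. *)
Lemma euler_like_separation (C L H : R) (P Q : nat -> nat -> R) (J : nat) :
  0 <= C -> 1 <= L -> 0 < H -> L * H <= 1 / 2 ->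
  euler_like C H P -> euler_like C H Q ->
  (forall j, rnorm d (vsub (g (P j)) (g (Q j))) <= L * rnorm d (vsub (P j) (Q j))) ->
  rnorm d (vsub (P O) (Q O))
  <= exp (2 * L * (INR J * H)) * (rnorm d (vsub (P J) (Q J)) + 2 * C * H).
Proof.
  intros HC HL HH HLH HP HQ Hlip.
  set (D := fun j => rnorm d (vsub (P j) (Q j))).
  (* Shifting by [2 C H] absorbs the defect of order [H^2] of each step and makes the recursion
     homogeneous. Solving for [D j] uses [1 <= (1 + 2 u) (1 - u)], valid for
     [0 <= u = L H <= 1 / 2]. *)
  assert (Hstep : forall j, D j + 2 * C * H <= (1 + 2 * L * H) * (D (S j) + 2 * C * H)).
  { intros j. assert (H1 : D j <= D (S j) + H * (L * D j) + 2 * (C * (H * H))).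
    { unfold D at 1.
      rewrite (rnorm_ext d _ (vadd (vadd (vsub (P (S j)) (Q (S j)))
         (vscal H (vsub (g (P j)) (g (Q j)))))
        (vsub (vadd (vsub (Q (S j)) (Q j)) (vscal H (g (Q j))))
           (vadd (vsub (P (S j)) (P j)) (vscal H (g (P j))))))).
      2:{ intros; unfold vadd, vsub, vscal; ring. }
      eapply Rle_trans; [apply rnorm_triang|].
      pose proof (rnorm_triang d (vsub (P (S j)) (Q (S j))) (vscal H (vsub (g (P j)) (g (Q j)))))
        as Ht.
      rewrite rnorm_scal, Rabs_pos_eq in Ht by lra.
      pose proof (rnorm_triang_sub d (vadd (vsub (Q (S j)) (Q j)) (vscal H (g (Q j))))
         (vadd (vsub (P (S j)) (P j)) (vscal H (g (P j))))) as Ht2.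
      pose proof (HP j). pose proof (HQ j).
      assert (H * rnorm d (vsub (g (P j)) (g (Q j))) <= H * (L * D j))
        by (apply Rmult_le_compat_l; [lra|apply Hlip]).
      unfold D in *. lra. }
    assert (0 <= D j) by apply rnorm_pos. assert (0 <= D (S j)) by apply rnorm_pos.
    set (u := L * H) in *. assert (Hu : 0 < u) by (unfold u; nra).
    assert (Hc2 : D j * (1 - u) <= D (S j) + 2 * (C * (H * H))) by (unfold u; nra).
    assert (Hc3 : D j <= (1 + 2 * u) * (D (S j) + 2 * (C * (H * H)))).
    { apply Rle_trans with ((1 + 2 * u) * (D j * (1 - u))).
      - assert (0 <= D j * (u * (1 - 2 * u))) by (apply Rmult_le_pos; [easy|nra]). lra.
      - apply Rmult_le_compat_l; lra. }
    assert (Hc4 : C * (H * H) <= C * (H * u)).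
    { apply Rmult_le_compat_l; [easy|]. unfold u. nra. }
    assert (0 <= C * H) by nra.
    assert ((1 + 2 * u) * (2 * (C * (H * H))) <= 2 * (2 * (C * (H * u)))).
    { assert (HX : 0 <= C * (H * H)) by (apply Rmult_le_pos; nra).
      apply Rle_trans with (2 * (2 * (C * (H * H)))); [|lra].
      apply Rmult_le_compat_r; lra. }
    replace (2 * L * H) with (2 * u) by (unfold u; ring). lra. }
  assert (Hind : D O + 2 * C * H <= (1 + 2 * L * H) ^ J * (D J + 2 * C * H)).
  { clear -Hstep HL HH. induction J as [|J IH]; [simpl; lra|].
    apply Rle_trans with (1 := IH).
    replace ((1 + 2 * L * H) ^ S J) with ((1 + 2 * L * H) ^ J * (1 + 2 * L * H)) by (simpl; ring).
    rewrite (Rmult_assoc (_ ^ J)). apply Rmult_le_compat_l; [apply pow_le; nra|apply Hstep]. }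
  assert (0 <= D J) by apply rnorm_pos.
  assert (0 <= C * H) by nra.
  assert (D O <= (1 + 2 * L * H) ^ J * (D J + 2 * C * H)) by lra.
  apply Rle_trans with ((1 + 2 * L * H) ^ J * (D J + 2 * C * H)); [easy|].
  apply Rmult_le_compat_r; [unfold D in *; lra|].
  replace (2 * L * (INR J * H)) with (INR J * (2 * L * H)) by ring.
  apply pow_le_exp. nra.
Qed.

End Approximation.

(** * An expanding cone for differences of stuck orbits *)

Section Cone.

Variable d : nat.
Variables z y : nat -> R.
Variable g : (nat -> R) -> nat -> R.
Hypothesis NI : near_ideal d z y g.

Notation q := (normsq d).
Notation a := (coord_z d z).
Notation b := (coord_y d y).
Notation p := (alignsq d z y).

(* [cone v = |v_s|^2 - |v_w|^2], where [v_s] is the component of [v] along [span(z,y)] and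
   [v_w] the orthogonal one; [reflect v = v_s - v_w]. *)
Definition reflect v := vsub (circ z y (2 * a v) (2 * b v)) v.
Definition cone v := rinner d (reflect v) v.

Lemma cone_eq v : cone v = 2 * p v - q v.
Proof. unfold cone, reflect, circ, alignsq, normsq. vexp. unfold coord_z, coord_y. ring. Qed.

Lemma cone_ext u v : (forall j, (j < d)%nat -> u j = v j) -> cone u = cone v.
Proof.
  intros H. rewrite !cone_eq. unfold alignsq, normsq, coord_z, coord_y.
  now rewrite (rinner_ext d z z u v), (rinner_ext d y y u v), (rinner_ext d u v u v).
Qed.

Lemma reflect_inner u v :
  rinner d (reflect u) v = 2 * (a u * a v + b u * b v) - rinner d u v.
Proof. unfold reflect, circ. vexp. unfold coord_z, coord_y. ring. Qed.

Lemma reflect_norm v : rnorm d (reflect v) = rnorm d v.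
Proof.
  unfold reflect. rewrite rnorm_sub_comm. unfold rnorm. f_equal.
  rewrite (circ_dist _ _ _ _ NI). unfold normsq. ring.
Qed.

Lemma cone_add u v : cone (vadd u v) = cone u + 2 * rinner d (reflect u) v + cone v.
Proof.
  rewrite !cone_eq, reflect_inner. unfold alignsq, normsq, coord_z, coord_y. vexp.
  rewrite (rinner_comm d v u). ring.
Qed.

Lemma cone_ge v : - rinner d v v <= cone v.
Proof. rewrite cone_eq. pose proof (alignsq_pos d z y v). unfold normsq. lra. Qed.

(** Twice the right-hand side is the rate of change of [cone (vsub P Q)] under the ideal flow. It
    dominates [p (vsub P Q)], which in turn is at least the cone value, so a positive cone value
    grows exponentially. *)
Lemma cone_drift P Q :
  q P <= 3 / 5 -> q Q <= 3 / 5 -> p P <= q P / 20 -> p Q <= q Q / 20 ->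
  0 <= cone (vsub P Q) ->
  68 / 100 * p (vsub P Q)
  <= - rinner d (reflect (vsub P Q)) (vsub (drift d z y P) (drift d z y Q)).
Proof.
  intros HqP HqQ HpP HpQ HV. rewrite cone_eq in HV. rewrite reflect_inner.
  pose proof (alignsq_le_normsq _ _ _ _ NI (vsub P Q)) as HD.
  pose proof (alignsq_pos d z y (vsub P Q)) as Hs0.
  assert (Ha : a (vsub (drift d z y P) (drift d z y Q))
    = (2 * q P - 2) * a P - (2 * q Q - 2) * a Q).
  { unfold drift, circ. unfold coord_z. vexp. rewrite (ni_zz _ _ _ _ NI), (ni_zy _ _ _ _ NI). ring. }
  assert (Hb : b (vsub (drift d z y P) (drift d z y Q))
    = (2 * q P - 2) * b P - (2 * q Q - 2) * b Q).
  { unfold drift, circ. unfold coord_y. vexp. rewrite (ni_yy _ _ _ _ NI), (yz _ _ _ _ NI). ring. }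
  assert (Hd : rinner d (vsub P Q) (vsub (drift d z y P) (drift d z y Q))
    = (q P + q Q) * q (vsub P Q) + (q P - q Q) * (q P - q Q) - q (vsub P Q) - p (vsub P Q)).
  { unfold drift, circ, alignsq, normsq, coord_z, coord_y. vexp.
    rewrite (rinner_comm d Q P), !(rinner_comm d _ z), !(rinner_comm d _ y). ring. }
  assert (HaD : a (vsub P Q) = a P - a Q) by (unfold coord_z; now vexp).
  assert (HbD : b (vsub P Q) = b P - b Q) by (unfold coord_y; now vexp).
  rewrite Ha, Hb, Hd. unfold alignsq in HpP, HpQ, HD, Hs0, HV |- *.
  rewrite HaD, HbD in *.
  pose proof (normsq_pos d P) as HqP0. pose proof (normsq_pos d Q) as HqQ0.
  set (a1 := a P) in *. set (a2 := a Q) in *. set (b1 := b P) in *. set (b2 := b Q) in *.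
  set (q1 := q P) in *. set (q2 := q Q) in *. set (D := q (vsub P Q)) in *.
  set (s := (a1 - a2) * (a1 - a2) + (b1 - b2) * (b1 - b2)) in *.
  set (mu := (a1 - a2) * (a1 + a2) + (b1 - b2) * (b1 + b2)).
  (* Symmetrising in [P] and [Q] turns the cubic terms into the square of
     [(P + Q)_w . (P - Q)_w = q1 - q2 - mu], whatever the distance between [P] and [Q]. *)
  replace (- _) with ((3 - 2 * (q1 + q2)) * s - (1 - (q1 + q2)) * D
    + (q1 - q2 - mu) * (q1 - q2 - mu) - mu * mu) by (unfold mu, s; ring).
  (* Cauchy-Schwarz in the plane, then [|P_s + Q_s|^2 <= 2 (p P + p Q) <= 2 (6 / 5) / 20 = 12 /
     100]. This is where stuckness of both points matters. *)
  assert (Hmu : mu * mu <= s * (12 / 100)).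
  { apply Rle_trans with (s * ((a1 + a2) * (a1 + a2) + (b1 + b2) * (b1 + b2))).
    - assert (0 <= ((a1 - a2) * (b1 + b2) - (b1 - b2) * (a1 + a2)) *
         ((a1 - a2) * (b1 + b2) - (b1 - b2) * (a1 + a2))) by apply Rle_0_sqr.
      unfold mu, s. nra.
    - apply Rmult_le_compat_l; [easy|].
      assert (0 <= (a1 - a2) * (a1 - a2)) by apply Rle_0_sqr.
      assert (0 <= (b1 - b2) * (b1 - b2)) by apply Rle_0_sqr. nra. }
  assert (0 <= (q1 - q2 - mu) * (q1 - q2 - mu)) by apply Rle_0_sqr.
  set (t := q1 + q2) in *. assert (0 <= t <= 6 / 5) by (unfold t; lra).
  (* For [t <= 1] the cone condition [D <= 2 s] yields the lower bound [s]. For [t > 1] the sign of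
     [1 - t] flips and [D >= s] yields [(2 - t) s], with [t <= 6 / 5]. *)
  assert (8 / 10 * s <= (3 - 2 * t) * s - (1 - t) * D); [|lra].
  destruct (Rle_or_lt t 1); nra.
Qed.

(** The drift gives [68 / 100 p], the perturbation takes at most [4 / 1000 q <= 8 / 1000 p], and
    [cone <= p] turns what remains into growth by [H cone]. The loss of order [H^2] is [8 C] from
    pairing the defects with a difference of norm at most [2], and [(32 + 2 C)^2] from the squared
    displacement, [16] being the Lipschitz constant of [g] on the unit ball. *)
Lemma cone_step C H P Q P' Q' :
  0 <= C -> 0 <= H <= 1 ->
  q P <= 3 / 5 -> q Q <= 3 / 5 -> p P <= q P / 20 -> p Q <= q Q / 20 ->
  rnorm d (vadd (vsub P' P) (vscal H (g P))) <= C * (H * H) ->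
  rnorm d (vadd (vsub Q' Q) (vscal H (g Q))) <= C * (H * H) ->
  0 <= cone (vsub P Q) ->
  cone (vsub P Q) + H * (cone (vsub P Q) - (8 * C + (32 + 2 * C) ^ 2) * H)
  <= cone (vsub P' Q').
Proof.
  intros HC HH HqP HqQ HpP HpQ HP HQ HV.
  pose proof (cone_drift P Q HqP HqQ HpP HpQ HV) as Hdrift.
  assert (HnP : rnorm d P <= 1) by (apply rnorm_le_of_sq; [lra|unfold normsq in *; lra]).
  assert (HnQ : rnorm d Q <= 1) by (apply rnorm_le_of_sq; [lra|unfold normsq in *; lra]).
  set (D := vsub P Q) in *.
  assert (HnD : rnorm d D <= 2) by (pose proof (rnorm_triang_sub d P Q); unfold D; lra).
  set (e1 := vadd (vsub P' P) (vscal H (g P))) in *.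
  set (e2 := vadd (vsub Q' Q) (vscal H (g Q))) in *.
  set (e := vsub e1 e2).
  assert (He : rnorm d e <= 2 * (C * (H * H))).
  { pose proof (rnorm_triang_sub d e1 e2). unfold e. lra. }
  set (m := vadd (vscal (- H) (vsub (g P) (g Q))) e).
  assert (Hcone : cone (vsub P' Q') = cone (vadd D m)).
  { apply cone_ext. intros; unfold m, e, e1, e2, D, vadd, vsub, vscal; ring. }
  rewrite Hcone, cone_add.
  pose proof (ni_lip _ _ _ _ NI 1 P Q ltac:(lra) HnP HnQ) as Hg.
  pose proof (ni_err _ _ _ _ NI 1 P Q ltac:(lra) HnP HnQ) as Hr. fold D in Hg, Hr.
  pose proof (rnorm_pos d D) as HD0. pose proof (rnorm_pos d e) as He0.
  pose proof (rnorm_pos d (vsub (g P) (g Q))) as Hg0.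
  assert (HH2 : 0 <= H * H <= H) by nra.
  assert (Hm : rnorm d m <= (32 + 2 * C) * H).
  { eapply Rle_trans; [apply rnorm_triang|]. rewrite rnorm_scal, Rabs_Ropp, Rabs_pos_eq by lra.
    nra. }
  assert (Hmm : rinner d m m <= (32 + 2 * C) ^ 2 * (H * H)).
  { rewrite <- rnorm_sq. pose proof (rnorm_pos d m).
    replace ((32 + 2 * C) ^ 2 * (H * H)) with (((32 + 2 * C) * H) * ((32 + 2 * C) * H)) by ring.
    apply Rmult_le_compat; lra. }
  pose proof (cone_ge m) as Hcm.
  assert (Hin : rinner d (reflect D) m
     = H * (- rinner d (reflect D) (vsub (drift d z y P) (drift d z y Q)))
       - H * rinner d (reflect D) (vsub (err d z y g P) (err d z y g Q))
       + rinner d (reflect D) e).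
  { unfold m, err. vexp. ring. }
  pose proof (cauchy_schwarz2 d (reflect D) (vsub (err d z y g P) (err d z y g Q))) as H1.
  pose proof (cauchy_schwarz2 d (reflect D) e) as H2.
  rewrite reflect_norm in H1, H2.
  assert (HDD : rnorm d D * rnorm d D = q D) by apply rnorm_sq.
  assert (Hs : q D <= 2 * p D) by (rewrite cone_eq in HV; lra).
  assert (Hs2 : cone D <= p D).
  { rewrite cone_eq. pose proof (alignsq_le_normsq _ _ _ _ NI D). lra. }
  assert (rnorm d D * rnorm d (vsub (err d z y g P) (err d z y g Q)) <= 4 / 1000 * q D).
  { rewrite <- HDD. nra. }
  assert (rnorm d D * rnorm d e <= 4 * (C * (H * H))) by nra.
  pose proof (alignsq_pos d z y D).
  assert (Hmain : H * (1 / 2 * p D) <= H * (- rinner d (reflect D) (vsub (drift d z y P) (drift d z y Q)))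
       - H * rinner d (reflect D) (vsub (err d z y g P) (err d z y g Q))).
  { rewrite <- Rmult_minus_distr_l. apply Rmult_le_compat_l; lra. }
  assert (H * cone D <= H * p D) by (apply Rmult_le_compat_l; lra).
  rewrite Hin. nra.
Qed.

(** An excess [t] over the threshold persists and adds at least [H t] at each index, whereas points
    of norm at most [1] have a difference of cone value at most [4]. *)
Lemma cone_trapped C H (P Q : nat -> nat -> R) J :
  0 <= C -> 0 < H <= 1 -> euler_like d g C H P -> euler_like d g C H Q ->
  (forall j, (J <= j)%nat -> q (P j) <= 3 / 5 /\ p (P j) <= q (P j) / 20) ->
  (forall j, (J <= j)%nat -> q (Q j) <= 3 / 5 /\ p (Q j) <= q (Q j) / 20) ->
  cone (vsub (P J) (Q J)) <= (8 * C + (32 + 2 * C) ^ 2) * H.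
Proof.
  intros HC HH HP HQ HPs HQs. set (C2 := 8 * C + (32 + 2 * C) ^ 2).
  apply Rnot_lt_le. intros Hlt. set (V := fun j => cone (vsub (P j) (Q j))).
  change (C2 * H < V J) in Hlt. set (t := V J - C2 * H).
  assert (HC2 : 0 <= C2) by (unfold C2; pose proof (pow2_ge_0 (32 + 2 * C)); lra).
  assert (Ht : 0 < t) by (unfold t; lra).
  assert (Hgrow : forall i, V J + INR i * (H * t) <= V (J + i)%nat).
  { induction i as [|i IH]; [rewrite Nat.add_0_r; simpl; lra|].
    rewrite Nat.add_succ_r, S_INR.
    destruct (HPs (J + i)%nat ltac:(lia)). destruct (HQs (J + i)%nat ltac:(lia)).
    assert (0 <= INR i * (H * t)) by (apply Rmult_le_pos; [apply pos_INR|nra]).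
    assert (Hst : V (J + i)%nat + H * (V (J + i)%nat - C2 * H) <= V (S (J + i))).
    { apply cone_step; try easy; [lra|]. fold (V (J + i)%nat). nra. }
    assert (H * t <= H * (V (J + i)%nat - C2 * H)) by (apply Rmult_le_compat_l; unfold t; lra).
    lra. }
  assert (Hb : forall j, (J <= j)%nat -> V j <= 4).
  { intros j Hj. unfold V. rewrite cone_eq. pose proof (alignsq_le_normsq _ _ _ _ NI (vsub (P j) (Q j))).
    assert (q (vsub (P j) (Q j)) <= 4); [|lra].
    destruct (HPs j Hj) as [HqP _]. destruct (HQs j Hj) as [HqQ _].
    assert (rnorm d (P j) <= 1) by (apply rnorm_le_of_sq; [lra|unfold normsq in *; lra]).
    assert (rnorm d (Q j) <= 1) by (apply rnorm_le_of_sq; [lra|unfold normsq in *; lra]).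
    pose proof (rnorm_triang_sub d (P j) (Q j)). pose proof (rnorm_pos d (vsub (P j) (Q j))).
    unfold normsq. rewrite <- rnorm_sq. nra. }
  assert (HHt : 0 < H * t) by nra.
  destruct (INR_unbounded (4 / (H * t))) as [i Hi].
  specialize (Hgrow i). specialize (Hb (J + i)%nat ltac:(lia)).
  apply Rgt_lt, Rlt_div_l in Hi; [|easy].
  assert (0 <= C2 * H) by nra. unfold t in *. lra.
Qed.

End Cone.

(** * Bad starting points and their end points *)

Section StuckSet.

Variable d : nat.
Variables z y : nat -> R.
Variable g : (nat -> R) -> nat -> R.
Hypothesis NI : near_ideal d z y g.

Notation q := (normsq d).
Notation a := (coord_z d z).
Notation b := (coord_y d y).
Notation p := (alignsq d z y).

(** The quantifiers are arranged for the negation: a good point has one [eta] below which no orbit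
    is stuck, and this supplies its step bound. The witnessing steps may vary with [eta]. *)
Definition stuck_point (x0 : nat -> R) : Prop :=
  forall eta, 0 < eta -> exists al x, is_orbit g al x /\ x O = x0 /\
    (forall k, 0 < al k <= eta) /\ is_lim_seq (fun K => sumR K al) p_infty /\
    stuck d z y x.

Definition ortho (x : nat -> R) : nat -> R := vsub x (circ z y (a x) (b x)).

Lemma ortho_sq x : rinner d (ortho x) (ortho x) = q x - p x.
Proof. unfold ortho. rewrite (circ_dist _ _ _ _ NI). unfold alignsq. ring. Qed.

Lemma ortho_z x : rinner d z (ortho x) = 0.
Proof.
  unfold ortho, circ. vexp. rewrite (ni_zz _ _ _ _ NI), (ni_zy _ _ _ _ NI). unfold coord_z. ring.
Qed.

Lemma ortho_sub u v j : ortho (vsub u v) j = ortho u j - ortho v j.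
Proof. unfold ortho, circ, coord_z, coord_y. vexp. unfold vsub, vadd, vscal. ring. Qed.

(* As [ortho v] is orthogonal to [z], its coordinate [j0] is controlled by the others:
   this is what makes cells in [d - 1] coordinates sufficient. *)
Lemma ortho_le_cells v j0 h :
  (j0 < d)%nat -> z j0 <> 0 -> (forall j, (j < d)%nat -> Rabs (z j) <= Rabs (z j0)) ->
  0 <= h -> (forall j, (j < d)%nat -> j <> j0 -> Rabs (ortho v j) <= h) ->
  q v - p v <= INR d ^ 3 * (h * h).
Proof.
  intros Hj0 Hz0 Hmax Hh Hcell.
  assert (Hd : 1 <= INR d) by (replace 1 with (INR 1) by easy; apply le_INR; lia).
  assert (H0 : Rabs (ortho v j0) <= INR d * h).
  { apply Rmult_le_reg_l with (Rabs (z j0)); [now apply Rabs_pos_lt|].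
    rewrite <- Rabs_mult.
    replace (z j0 * ortho v j0) with
      (- sumR d (fun j => z j * ortho v j - Defs.ind (Nat.eqb j0 j) * (z j * ortho v j))).
    - rewrite Rabs_Ropp. eapply Rle_trans; [apply sumR_abs|].
      replace (Rabs (z j0) * (INR d * h)) with (INR d * (Rabs (z j0) * h)) by ring.
      rewrite <- sumR_const. apply sumR_le. intros j Hj.
      destruct (Nat.eqb_spec j0 j) as [<-|Hne]; unfold Defs.ind.
      + replace (_ - _) with 0 by ring. rewrite Rabs_R0. apply Rmult_le_pos; [apply Rabs_pos|easy].
      + rewrite Rmult_0_l, Rminus_0_r, Rabs_mult.
        apply Rmult_le_compat; try apply Rabs_pos; [now apply Hmax|].
        apply Hcell; [easy|congruence].
    - rewrite (sumR_ext d _ (fun j => z j * ortho v j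
        + (-1) * (Defs.ind (Nat.eqb j0 j) * (z j * ortho v j)))) by (intros; ring).
      rewrite sumR_plus, sumR_scal, (sumR_delta d j0 (fun j => z j * ortho v j)) by easy.
      change (sumR d (fun j => z j * ortho v j)) with (rinner d z (ortho v)).
      rewrite ortho_z. ring. }
  rewrite <- ortho_sq.
  apply Rle_trans with (sumR d (fun _ => (INR d * h) * (INR d * h))).
  - apply sumR_le. intros j Hj.
    assert (Hb : Rabs (ortho v j) <= INR d * h).
    { destruct (Nat.eq_dec j j0) as [->|Hne]; [easy|].
      specialize (Hcell j Hj Hne). nra. }
    pose proof (Rabs_pos (ortho v j)).
    assert (Rabs (ortho v j) * Rabs (ortho v j) = ortho v j * ortho v j).
    { rewrite <- Rabs_mult. apply Rabs_pos_eq. apply Rle_0_sqr. }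
    nra.
  - rewrite sumR_const. right. ring.
Qed.

Lemma small_step_exists R2 : 0 <= R2 -> exists A, 0 < A /\ forall al, 0 < al <= A -> small_step R2 al.
Proof.
  intros HR. assert (HK : 0 < 16 * (3 * R2 + 1) ^ 2) by nra.
  exists (1 / 100 / (16 * (3 * R2 + 1) ^ 2)). split.
  - apply Rdiv_lt_0_compat; lra.
  - intros al Hal. split; [lra|]. apply Rle_div_r; [easy|apply Hal].
Qed.

(** Since [q] falls at rate [1 / 20], it is below [3 / 5] after any time [T0 > 20 R2]. Blocks of
    length [1 / N] make index [T0 * N] stand for time at least [T0], simultaneously for all bad
    points; [C] and [T0] depend neither on [N] nor on the point. *)
Lemma stuck_representative R2 :
  2 <= R2 -> exists C T0 : nat, forall N, (1 <= N)%nat -> forall x0, q x0 <= R2 ->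
    stuck_point x0 -> exists P, P O = x0 /\ euler_like d g (INR C) (/ INR N) P /\
      (forall j, rnorm d (P j) <= R2) /\
      (forall j, (T0 * N <= j)%nat -> q (P j) <= 3 / 5 /\ p (P j) <= q (P j) / 20).
Proof.
  intros HR.
  set (L := 4 * (3 * (R2 * R2) + 1)). set (G := 4 * (3 * R2 + 1) * R2).
  destruct (INR_unbounded ((4 * L + 1) * G)) as [C HC].
  destruct (INR_unbounded (20 * R2)) as [T0 HT0].
  exists C, T0. intros N HN x0 Hx0 Hs.
  assert (HN1 : 1 <= INR N) by (replace 1 with (INR 1) by easy; apply le_INR; lia).
  assert (HH : 0 < / INR N <= 1).
  { split; [apply Rinv_0_lt_compat; lra|]. rewrite <- Rinv_1. apply Rinv_le_contravar; lra. }
  set (H := / INR N) in *.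
  destruct (small_step_exists R2 ltac:(lra)) as (A & HA & HsA).
  assert (HHH : 0 < H * H) by nra.
  destruct (Hs (Rmin A (H * H)) ltac:(now apply Rmin_glb_lt)) as (al & x & Hx & Hx0' & Hal & Hdiv & Hst).
  assert (Hal1 : forall k, 0 < al k <= A)
    by (intros k; destruct (Hal k); pose proof (Rmin_l A (H * H)); lra).
  assert (Hal2 : forall k, 0 < al k <= H * H)
    by (intros k; destruct (Hal k); pose proof (Rmin_r A (H * H)); lra).
  assert (Hal3 : forall k, small_step R2 (al k)) by (intros; apply HsA, Hal1).
  rewrite <- Hx0' in Hx0.
  pose proof (orbit_bounded _ _ _ _ NI R2 al x HR Hx Hal3 Hx0) as Hb.
  assert (Hn : forall k, rnorm d (x k) <= R2).
  { intros k. apply rnorm_le_of_sq; [lra|]. pose proof (Hb k). unfold normsq in *. nra. }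
  destruct (subsampled_orbit d g al x L G H) as (P & HP0 & HP & HPk); try easy.
  - unfold L; nra.
  - unfold G; nra.
  - intros i. apply Rle_trans with (1 := g_bound _ _ _ _ NI (x i)). unfold G.
    pose proof (Hb i). pose proof (Hn i). pose proof (normsq_pos d (x i)).
    apply Rmult_le_compat; [nra|apply rnorm_pos|nra|easy].
  - intros i j. apply (ni_lip _ _ _ _ NI); [lra|easy|easy].
  - exists P. split; [congruence|]. split; [|split].
    + intros j. apply Rle_trans with (1 := HP j). apply Rmult_le_compat_r; lra.
    + intros j. destruct (HPk j) as (k & -> & _). easy.
    + intros j Hj. destruct (HPk j) as (k & -> & Hk).
      assert (Hq : q (x k) <= 3 / 5).
      { apply Rle_trans with (1 := stuck_time _ _ _ _ NI R2 al x HR Hx Hal3 Hx0 Hst k).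
        apply Rmax_lub; [lra|].
        assert (INR T0 <= INR j * H).
        { apply Rmult_le_reg_r with (INR N); [lra|]. unfold H.
          rewrite Rmult_assoc, Rinv_l, Rmult_1_r by lra. rewrite <- mult_INR. now apply le_INR. }
        lra. }
      split; [easy|]. apply Hst. lra.
Qed.

(** [W x0] is the component orthogonal to [z] and [y] of an end point of [x0]. By
    [q = 2 (q - p) + cone], applied to a difference of end points, closeness of [W] makes end points
    close; the backward estimate then makes starting points close. *)
Lemma stuck_separation R2 j0 :
  2 <= R2 -> (j0 < d)%nat -> z j0 <> 0 ->
  (forall j, (j < d)%nat -> Rabs (z j) <= Rabs (z j0)) ->
  exists C, 0 <= C /\ forall M, (1 <= M)%nat -> exists W : (nat -> R) -> nat -> R,
    (forall x0, q x0 <= R2 -> stuck_point x0 -> forall j, (j < d)%nat -> Rabs (W x0 j) <= 1) /\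
    (forall x0 x1, q x0 <= R2 -> stuck_point x0 -> q x1 <= R2 -> stuck_point x1 ->
      (forall j, (j < d)%nat -> j <> j0 -> Rabs (W x0 j - W x1 j) <= / INR M) ->
      rnorm d (vsub x0 x1) <= C * / INR M).
Proof.
  intros HR Hj0 Hz0 Hmax.
  destruct (stuck_representative R2 HR) as (C & T0 & Hrep).
  set (L := 4 * (3 * (R2 * R2) + 1)).
  assert (HL : 1 <= L) by (unfold L; nra).
  destruct (INR_unbounded (2 * L)) as [N2 HN2].
  set (C2 := 8 * INR C + (32 + 2 * INR C) ^ 2).
  set (C3 := 2 * INR d ^ 3 + C2 + 1).
  exists (exp (2 * L * INR T0) * (C3 + 2 * INR C)).
  assert (HC0 : 0 <= INR C) by apply pos_INR.
  assert (HC2 : 0 <= C2) by (unfold C2; pose proof (pow2_ge_0 (32 + 2 * INR C)); lra).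
  assert (Hd3 : 0 <= INR d ^ 3) by apply pow_le, pos_INR.
  split.
  { apply Rmult_le_pos; [left; apply exp_pos|unfold C3; lra]. }
  (* With [N] of order [M^2], the cone error [C2 * H] is of order [h^2], the square of the distance
     aimed at. The factor [S N2] gives [2 L H <= h^2], as the backward estimate requires. *)
  intros M HM. set (N := (M * M * S N2)%nat).
  assert (HN1 : (1 <= N)%nat) by (unfold N; nia).
  assert (HM1 : 1 <= INR M) by (replace 1 with (INR 1) by easy; apply le_INR; lia).
  assert (HNR : INR M * INR M * (2 * L) <= INR N).
  { unfold N. rewrite !mult_INR, S_INR. apply Rmult_le_compat_l; [nra|lra]. }
  set (H := / INR N). set (h := / INR M).
  assert (Hh : 0 < h <= 1).
  { unfold h. split; [apply Rinv_0_lt_compat; lra|]. rewrite <- Rinv_1. apply Rinv_le_contravar; lra. }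
  assert (HN0 : 0 < INR N) by nra.
  assert (HH0 : 0 < H) by now apply Rinv_0_lt_compat.
  assert (HLH : H * (2 * L) <= h * h).
  { unfold H, h. rewrite <- Rinv_mult. apply Rmult_le_reg_l with (INR N); [easy|].
    rewrite <- Rmult_assoc, Rinv_r, Rmult_1_l by lra.
    apply Rmult_le_reg_r with (INR M * INR M); [nra|].
    rewrite (Rmult_assoc (INR N)), Rinv_l by nra. lra. }
  assert (Hhh : h * h <= h) by nra.
  assert (HHh : H <= h * h) by nra.
  destruct (choice (fun x0 P => q x0 <= R2 -> stuck_point x0 ->
     P O = x0 /\ euler_like d g (INR C) H P /\ (forall j, rnorm d (P j) <= R2) /\
      (forall j, (T0 * N <= j)%nat -> q (P j) <= 3 / 5 /\ p (P j) <= q (P j) / 20)))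
    as [rep Hr].
  { intros x0. destruct (classic (q x0 <= R2 /\ stuck_point x0)) as [[H1 H2]|Hn].
    - destruct (Hrep N HN1 x0 H1 H2) as [P HP]. now exists P.
    - exists (fun _ => x0). intros H1 H2. exfalso. now apply Hn. }
  set (J := (T0 * N)%nat) in *.
  exists (fun x0 => ortho (rep x0 J)). split.
  - intros x0 H1 H2 j Hj. destruct (Hr x0 H1 H2) as (_ & _ & _ & Hs).
    destruct (Hs J (Nat.le_refl J)) as [Hq _].
    apply Rle_trans with (1 := rnorm_coord d _ j Hj).
    apply rnorm_le_of_sq; [lra|]. rewrite ortho_sq.
    pose proof (alignsq_pos d z y (rep x0 J)). lra.
  - intros x0 x1 H1 H2 H3 H4 Hcell.
    destruct (Hr x0 H1 H2) as (HP0 & HP & HPR & HPs).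
    destruct (Hr x1 H3 H4) as (HQ0 & HQ & HQR & HQs).
    pose proof (cone_trapped _ _ _ _ NI (INR C) H (rep x0) (rep x1) J HC0 ltac:(lra) HP HQ HPs HQs)
      as Hc.
    fold C2 in Hc. rewrite cone_eq in Hc.
    pose proof (ortho_le_cells (vsub (rep x0 J) (rep x1 J)) j0 h Hj0 Hz0 Hmax ltac:(lra)) as Ho.
    assert (Ho' : q (vsub (rep x0 J) (rep x1 J)) - p (vsub (rep x0 J) (rep x1 J))
       <= INR d ^ 3 * (h * h)).
    { apply Ho. intros j Hj Hne. rewrite ortho_sub. now apply Hcell. }
    assert (HJ : rnorm d (vsub (rep x0 J) (rep x1 J)) <= C3 * h).
    { apply rnorm_le_of_sq; [unfold C3; nra|].
      change (q (vsub (rep x0 J) (rep x1 J)) <= C3 * h * (C3 * h)).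
      assert (C2 * H <= C2 * (h * h)) by now apply Rmult_le_compat_l.
      apply Rle_trans with (C3 * (h * h)).
      - unfold C3. nra.
      - replace (C3 * h * (C3 * h)) with (C3 * C3 * (h * h)) by ring.
        apply Rmult_le_compat_r; [nra|]. assert (1 <= C3) by (unfold C3; lra). nra. }
    pose proof (euler_like_separation d g (INR C) L H (rep x0) (rep x1) J HC0 HL HH0
      ltac:(lra) HP HQ) as Hsep.
    rewrite HP0, HQ0 in Hsep.
    eapply Rle_trans.
    { apply Hsep. intros j. apply (ni_lip _ _ _ _ NI); [lra|easy|easy]. }
    replace (INR J * H) with (INR T0).
    2:{ unfold J, H. rewrite mult_INR. field. lra. }
    rewrite (Rmult_assoc (exp _)). apply Rmult_le_compat_l; [left; apply exp_pos|].
    fold h. assert (INR C * H <= INR C * h) by (apply Rmult_le_compat_l; lra). lra.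
Qed.

End StuckSet.

(** * The stuck set is null *)

(** The digit of coordinate [j] is the floor of [(u x j + 1) * INR M], between [0] and [2 M]; [cl]
    reads the digits in base [2 M + 1]. *)
Lemma grid_classes (X : Type) (A : X -> Prop) (u : X -> nat -> R) (M D : nat) :
  (1 <= M)%nat ->
  (forall x, A x -> forall j, (j < D)%nat -> Rabs (u x j) <= 1) ->
  exists cl : X -> nat,
    (forall x, A x -> (cl x < (2 * M + 1) ^ D)%nat) /\
    (forall x x', A x -> A x' -> cl x = cl x' ->
       forall j, (j < D)%nat -> Rabs (u x j - u x' j) <= / INR M).
Proof.
  intros HM. assert (HM0 : 0 < INR M) by (apply lt_0_INR; lia).
  induction D as [|D IH]; intros Hu.
  - exists (fun _ => O). split; [intros; simpl; lia|intros; lia].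
  - destruct IH as (cl & Hcl & Hsame); [intros; apply Hu; [easy|lia]|].
    assert (Hdig : forall x, exists n : nat, A x ->
      (n < 2 * M + 1)%nat /\ INR n <= (u x D + 1) * INR M < INR n + 1).
    { intros x. destruct (classic (A x)) as [Hx|Hx]; [|now exists O].
      specialize (Hu x Hx D ltac:(lia)). apply Rabs_le_between in Hu.
      destruct (nfloor_ex ((u x D + 1) * INR M)) as [n Hn]; [nra|].
      exists n. intros _. split; [|easy]. apply INR_lt.
      rewrite plus_INR, mult_INR. simpl (INR 2). simpl (INR 1). nra. }
    apply choice in Hdig. destruct Hdig as [dig Hdig].
    exists (fun x => ((2 * M + 1) * cl x + dig x)%nat). split.
    + intros x Hx. specialize (Hcl x Hx). destruct (Hdig x Hx) as [Hd _].
      cbn [Nat.pow]. apply Nat.lt_le_trans with ((2 * M + 1) * S (cl x))%nat; [lia|].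
      now apply Nat.mul_le_mono_l.
    + intros x x' Hx Hx' Heq j Hj.
      destruct (Hdig x Hx) as [Hd1 Hd2]. destruct (Hdig x' Hx') as [Hd1' Hd2'].
      pose proof (Nat.div_mod_unique _ _ _ _ _ Hd1 Hd1' Heq) as Hc.
      destruct Hc as [Hc1 Hc2].
      destruct (Nat.eq_dec j D) as [->|Hne]; [|apply Hsame; try easy; lia].
      rewrite Hc2 in Hd2. apply Rmult_le_reg_r with (INR M); [easy|].
      rewrite Rinv_l by lra. rewrite <- (Rabs_pos_eq (INR M)) at 1 by lra.
      rewrite <- Rabs_mult. apply Rabs_le. nra.
Qed.

(** [lebesgue_null d A] unfolds to [covered d A eps] for all [eps > 0]; naming the bound lets
    volumes be computed first and compared with [eps] afterwards. *)
Definition covered (d : nat) (A : (nat -> R) -> Prop) (v : R) : Prop :=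
  exists lo hi : nat -> nat -> R,
    (forall k j, lo k j <= hi k j) /\
    (forall K, sumR K (fun k => prodR d (fun j => hi k j - lo k j)) <= v) /\
    (forall x, A x -> exists k, forall j, (j < d)%nat -> lo k j <= x j <= hi k j).

Lemma prodR_const d c : prodR d (fun _ => c) = c ^ d.
Proof. induction d as [|d IH]; simpl; [easy|]. rewrite IH. ring. Qed.

Lemma prodR_pos d f : (forall j, 0 <= f j) -> 0 <= prodR d f.
Proof. intros H. induction d as [|d IH]; simpl; [lra|]. apply Rmult_le_pos; auto. Qed.

Lemma covered_mono d A B v w :
  (forall x, A x -> B x) -> v <= w -> covered d B v -> covered d A w.
Proof.
  intros HAB Hvw (lo & hi & H1 & H2 & H3). exists lo, hi. repeat split; [easy| |auto].
  intros K. now apply Rle_trans with (1 := H2 K).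
Qed.

Lemma covered_classes d (A : (nat -> R) -> Prop) (cl : (nat -> R) -> nat) K rho :
  (1 <= d)%nat -> 0 <= rho ->
  (forall x, A x -> (cl x < K)%nat) ->
  (forall x x', A x -> A x' -> cl x = cl x' -> forall j, (j < d)%nat -> Rabs (x j - x' j) <= rho) ->
  covered d A (INR K * (2 * rho) ^ d).
Proof.
  intros Hd Hrho Hcl Hsame.
  destruct (choice (fun c x => (exists x', A x' /\ cl x' = c) -> A x /\ cl x = c)) as [rep Hrep].
  { intros c. destruct (classic (exists x', A x' /\ cl x' = c)) as [[x' Hx']|Hn].
    - now exists x'.
    - exists (fun _ => 0). intros H. now destruct Hn. }
  (* One box of half-side [rho] around a representative of each class. Indices from [K] on get a
     degenerate box, of volume [0] because [d >= 1]. *)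
  exists (fun k j => if Nat.ltb k K then rep k j - rho else 0),
    (fun k j => if Nat.ltb k K then rep k j + rho else 0). repeat split.
  - intros k j. destruct (Nat.ltb k K); lra.
  - assert (Hv : 0 <= (2 * rho) ^ d) by (apply pow_le; lra).
    assert (Hvol : forall k, prodR d (fun j => (if Nat.ltb k K then rep k j + rho else 0) -
       (if Nat.ltb k K then rep k j - rho else 0)) = if Nat.ltb k K then (2 * rho) ^ d else 0).
    { intros k. destruct (Nat.ltb k K).
      - rewrite <- prodR_const. clear. induction d as [|d IH]; simpl; [easy|].
        rewrite IH. f_equal. ring.
      - destruct d as [|d']; [lia|]. simpl. ring. }
    intros n. rewrite (sumR_ext n _ (fun k => if Nat.ltb k K then (2 * rho) ^ d else 0)).
    2:{ intros k _. apply Hvol. }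
    apply Rle_trans with (INR (Nat.min n K) * (2 * rho) ^ d).
    + induction n as [|n IH]; [simpl; lra|]. cbn [sumR].
      destruct (Nat.ltb_spec n K).
      * replace (Nat.min (S n) K) with (S (Nat.min n K)) by lia. rewrite S_INR. lra.
      * replace (Nat.min (S n) K) with (Nat.min n K) by lia. lra.
    + apply Rmult_le_compat_r; [easy|]. apply le_INR. lia.
  - intros x Hx. exists (cl x). intros j Hj.
    destruct (Nat.ltb_spec (cl x) K); [|specialize (Hcl x Hx); lia].
    destruct (Hrep (cl x)) as [HA Hc]; [now exists x|].
    specialize (Hsame x (rep (cl x)) Hx HA (eq_sym Hc) j Hj).
    apply Rabs_le_between in Hsame. lra.
Qed.

Lemma sumR_delta_le d k c : 0 <= c -> sumR d (fun j => Defs.ind (Nat.eqb k j) * c) <= c.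
Proof.
  intros Hc. destruct (Nat.lt_ge_cases k d) as [Hk|Hk].
  - right. apply (sumR_delta d k (fun _ => c) Hk).
  - rewrite (sumR_ext d _ (fun _ => 0)), sumR_0; [easy|].
    intros j Hj. destruct (Nat.eqb_spec k j); [lia|]. unfold Defs.ind. ring.
Qed.

(** Both entries of the pair numbered [k] are at most [k], so the first [K] pairs are distinct cells
    of a [K] by [K] square. The indicator in [w] turns this count into an exchange of sums. *)
Lemma sumR_cantor (v : nat -> nat -> R) K :
  (forall i j, 0 <= v i j) ->
  sumR K (fun k => v (fst (of_nat k)) (snd (of_nat k))) <= sumR K (fun i => sumR K (v i)).
Proof.
  intros Hv. set (w := fun k i j => Defs.ind (Nat.eqb (to_nat (i, j)) k) * v i j).
  assert (Hw : forall k i j, 0 <= w k i j).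
  { intros. unfold w, Defs.ind. destruct (Nat.eqb _ _); pose proof (Hv i j); lra. }
  apply Rle_trans with (sumR K (fun k => sumR K (fun i => sumR K (fun j => w k i j)))).
  - apply sumR_le. intros k Hk.
    destruct (of_nat k) as [i j] eqn:E.
    assert (Hij : to_nat (i, j) = k) by (rewrite <- E; apply cancel_to_of).
    pose proof (to_nat_non_decreasing i j) as Hle. simpl.
    apply Rle_trans with (w k i j).
    + unfold w. rewrite Hij, Nat.eqb_refl. unfold Defs.ind. lra.
    + apply Rle_trans with (sumR K (fun j => w k i j)).
      * apply (sumR_term_le K (fun j => w k i j)); [lia|easy].
      * apply (sumR_term_le K (fun i => sumR K (fun j => w k i j))); [lia|].
        intros; now apply sumR_pos.
  - rewrite sumR_swap. apply sumR_le. intros i _. rewrite sumR_swap. apply sumR_le. intros j _.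
    now apply sumR_delta_le.
Qed.

Lemma lebesgue_null_union d (A : nat -> (nat -> R) -> Prop) :
  (forall i, lebesgue_null d (A i)) -> lebesgue_null d (fun x => exists i, A i x).
Proof.
  intros HA eps Heps.
  assert (Hc : forall i, exists b : (nat -> nat -> R) * (nat -> nat -> R),
    (forall k j, fst b k j <= snd b k j) /\
    (forall K, sumR K (fun k => prodR d (fun j => snd b k j - fst b k j)) <= eps * (/ 2) ^ S i) /\
    (forall x, A i x -> exists k, forall j, (j < d)%nat -> fst b k j <= x j <= snd b k j)).
  { intros i. destruct (HA i (eps * (/ 2) ^ S i)) as (lo & hi & H).
    - apply Rmult_lt_0_compat; [easy|]. apply pow_lt. lra.
    - now exists (lo, hi). }
  apply choice in Hc. destruct Hc as [bx Hbx].
  exists (fun k => fst (bx (fst (of_nat k))) (snd (of_nat k))),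
    (fun k => snd (bx (fst (of_nat k))) (snd (of_nat k))). repeat split.
  - intros k j. apply Hbx.
  - intros K.
    eapply Rle_trans.
    { apply (sumR_cantor (fun i k => prodR d (fun j => snd (bx i) k j - fst (bx i) k j))).
      intros i k. apply prodR_pos. intros j. destruct (Hbx i) as [H _].
      specialize (H k j). lra. }
    apply Rle_trans with (sumR K (fun i => eps * (/ 2) ^ S i)).
    { apply sumR_le. intros i _. apply Hbx. }
    apply Rle_trans with (eps * (1 - (/ 2) ^ K)).
    + right. induction K as [|K IH]; [simpl; ring|]. cbn [sumR]. rewrite IH. simpl. field.
    + assert (0 <= (/ 2) ^ K) by (apply pow_le; lra). nra.
  - intros x [i Hx]. destruct (Hbx i) as (_ & _ & H). destruct (H x Hx) as [k Hk].
    exists (to_nat (i, k)). intros j Hj. rewrite cancel_of_to. now apply Hk.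
Qed.

Lemma max_coordinate (z : nat -> R) d :
  (1 <= d)%nat -> exists j0, (j0 < d)%nat /\ forall j, (j < d)%nat -> Rabs (z j) <= Rabs (z j0).
Proof.
  induction d as [|d IH]; intros Hd; [lia|].
  destruct (Nat.eq_dec d 0) as [->|Hne].
  - exists O. split; [lia|]. intros j Hj. replace j with O by lia. lra.
  - destruct IH as (j0 & H0 & H1); [lia|].
    destruct (Rle_or_lt (Rabs (z d)) (Rabs (z j0))) as [H|H].
    + exists j0. split; [lia|]. intros j Hj.
      destruct (Nat.eq_dec j d) as [->|]; [easy|apply H1; lia].
    + exists d. split; [lia|]. intros j Hj.
      destruct (Nat.eq_dec j d) as [->|]; [lra|]. specialize (H1 j ltac:(lia)). lra.
Qed.

Lemma stuck_null d z y g lam :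
  near_ideal d z y g -> (1 <= d)%nat -> 0 < lam ->
  lebesgue_null d (fun x => stuck_point d z y g (vscal (/ lam) x)).
Proof.
  intros NI Hd Hlam.
  destruct (max_coordinate z d Hd) as (j0 & Hj0 & Hmax).
  assert (Hz0 : z j0 <> 0).
  { intros H0. pose proof (ni_zz _ _ _ _ NI) as H. unfold rinner in H.
    rewrite (sumR_ext d _ (fun _ => 0)), sumR_0 in H; [lra|].
    intros j Hj. specialize (Hmax j Hj). rewrite H0, Rabs_R0 in Hmax.
    assert (Rabs (z j) = 0) by (pose proof (Rabs_pos (z j)); lra).
    apply Rabs_eq_0 in H1. rewrite H1. ring. }
  (* The constants of [stuck_separation] depend on the radius, so the set is cut into countably many
     bounded pieces. *)
  set (A := fun (i : nat) x => normsq d (vscal (/ lam) x) <= INR i + 2 /\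
     stuck_point d z y g (vscal (/ lam) x)).
  assert (HA : forall i, lebesgue_null d (A i)).
  { intros i eps Heps.
    destruct (stuck_separation _ _ _ _ NI (INR i + 2) j0) as (C & HC & Hsep); try easy.
    { pose proof (pos_INR i). lra. }
    destruct d as [|D]; [lia|]. set (d := S D) in *.
    (* As [2 M + 1 <= 3 M], the [(2 M + 1)^D] boxes of side [2 lam C / M] in dimension [d = D + 1]
       have total volume at most [3^D (2 lam C)^d / M]. *)
    destruct (INR_unbounded (3 ^ D * (2 * (lam * C)) ^ d / eps)) as [M HM].
    assert (HM0 : 0 <= 3 ^ D * (2 * (lam * C)) ^ d / eps).
    { apply Rmult_le_pos; [|left; now apply Rinv_0_lt_compat].
      apply Rmult_le_pos; apply pow_le; nra. }
    assert (HMpos : 0 < INR M) by lra.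
    assert (HM1 : (1 <= M)%nat) by (apply (INR_lt 0) in HMpos; lia).
    destruct (Hsep M HM1) as (W & HW1 & HW2).
    (* The reindexing skips coordinate [j0], so the grid lives in [D = d - 1] coordinates. *)
    destruct (grid_classes _ (A i)
      (fun x j => W (vscal (/ lam) x) (if Nat.ltb j j0 then j else S j)) M D HM1)
      as (cl & Hcl1 & Hcl2).
    { intros x [Hx1 Hx2] j Hj. apply HW1; [easy|easy|].
      destruct (Nat.ltb_spec j j0); unfold d; lia. }
    apply (covered_mono d (A i) (A i) (INR ((2 * M + 1) ^ D) * (2 * (lam * (C * / INR M))) ^ d)).
    - easy.
    - rewrite pow_INR. rewrite plus_INR, mult_INR. simpl (INR 2). simpl (INR 1).
      assert (HM1' : 1 <= INR M) by (replace 1 with (INR 1) by easy; now apply le_INR).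
      apply Rle_trans with ((3 * INR M) ^ D * (2 * (lam * (C * / INR M))) ^ d).
      + apply Rmult_le_compat_r.
        * apply pow_le. assert (0 < / INR M) by now apply Rinv_0_lt_compat.
          assert (0 <= C * / INR M) by nra. nra.
        * apply pow_incr. lra.
      + set (B := 2 * (lam * C)) in *.
        replace (2 * (lam * (C * / INR M))) with (B * / INR M) by (unfold B; ring).
        assert (HMD : INR M ^ D * (/ INR M) ^ D = 1).
        { rewrite <- Rpow_mult_distr, Rinv_r, pow1; lra. }
        rewrite (Rpow_mult_distr 3), (Rpow_mult_distr B).
        change ((/ INR M) ^ d) with (/ INR M * (/ INR M) ^ D).
        replace (3 ^ D * INR M ^ D * (B ^ d * (/ INR M * (/ INR M) ^ D)))
          with (3 ^ D * B ^ d * (INR M ^ D * (/ INR M) ^ D) * / INR M) by ring.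
        rewrite HMD, Rmult_1_r. apply Rle_div_l; [easy|].
        apply Rgt_lt, Rlt_div_l in HM; [|easy]. lra.
    - apply (covered_classes d (A i) cl).
      + easy.
      + assert (0 < / INR M) by now apply Rinv_0_lt_compat. assert (0 <= C * / INR M) by nra. nra.
      + easy.
      + intros x x' Hx Hx' Heq j Hj.
        pose proof (Hcl2 x x' Hx Hx' Heq) as Hc.
        destruct Hx as [Hx1 Hx2]. destruct Hx' as [Hx1' Hx2'].
        assert (Hn : rnorm d (vsub (vscal (/ lam) x) (vscal (/ lam) x')) <= C * / INR M).
        { apply HW2; try easy. intros j' Hj' Hne.
          destruct (Nat.lt_ge_cases j' j0) as [Hlt|Hge].
          - specialize (Hc j' ltac:(lia)).
            destruct (Nat.ltb_spec j' j0); [easy|lia].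
          - specialize (Hc (pred j') ltac:(unfold d in *; lia)).
            destruct (Nat.ltb_spec (pred j') j0); [lia|].
            now replace (S (pred j')) with j' in Hc by lia. }
        pose proof (rnorm_coord d (vsub (vscal (/ lam) x) (vscal (/ lam) x')) j Hj) as Hcj.
        replace (vsub _ _ j) with (/ lam * (x j - x' j)) in Hcj by (unfold vsub, vscal; ring).
        rewrite Rabs_mult, Rabs_pos_eq in Hcj by (left; now apply Rinv_0_lt_compat).
        apply Rmult_le_reg_l with (/ lam); [now apply Rinv_0_lt_compat|].
        rewrite <- Rmult_assoc, Rinv_l, Rmult_1_l by lra. lra. }
  intros eps Heps.
  apply (covered_mono d _ (fun x => exists i, A i x) eps); [|lra|].
  - intros x Hx. destruct (INR_unbounded (normsq d (vscal (/ lam) x))) as [i Hi].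
    exists i. split; [lra|easy].
  - now apply (lebesgue_null_union d A HA).
Qed.

(** * Tensors *)

Lemma tinner_plus d A A' B :
  tinner d (fun i j k l => A i j k l + A' i j k l) B = tinner d A B + tinner d A' B.
Proof.
  unfold tinner.
  rewrite <- sumR_plus; apply sumR_ext; intros i _.
  rewrite <- sumR_plus; apply sumR_ext; intros j _.
  rewrite <- sumR_plus; apply sumR_ext; intros k _.
  rewrite <- sumR_plus; apply sumR_ext; intros l _. ring.
Qed.

Lemma tinner_scal d c A B :
  tinner d (fun i j k l => c * A i j k l) B = c * tinner d A B.
Proof.
  unfold tinner.
  rewrite <- sumR_scal; apply sumR_ext; intros i _.
  rewrite <- sumR_scal; apply sumR_ext; intros j _.
  rewrite <- sumR_scal; apply sumR_ext; intros k _.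
  rewrite <- sumR_scal; apply sumR_ext; intros l _. ring.
Qed.

Lemma tinner_ext d A A' B B' :
  (forall i j k l, (i < d)%nat -> (j < d)%nat -> (k < d)%nat -> (l < d)%nat ->
     A i j k l * B i j k l = A' i j k l * B' i j k l) -> tinner d A B = tinner d A' B'.
Proof.
  intros H. unfold tinner.
  apply sumR_ext; intros i Hi. apply sumR_ext; intros j Hj.
  apply sumR_ext; intros k Hk. apply sumR_ext; intros l Hl. now apply H.
Qed.

Lemma tinner_sub d A A' B : tinner d (tsub A A') B = tinner d A B - tinner d A' B.
Proof.
  replace (tinner d A B - tinner d A' B) with (tinner d A B + (-1) * tinner d A' B) by ring.
  rewrite <- tinner_scal, <- tinner_plus. apply tinner_ext; intros. unfold tsub. ring.
Qed.

Lemma tinner_0 d B : tinner d (fun _ _ _ _ => 0) B = 0.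
Proof.
  unfold tinner. rewrite (sumR_ext d _ (fun _ => 0)), sumR_0; [easy|]. intros i _.
  rewrite (sumR_ext d _ (fun _ => 0)), sumR_0; [easy|]. intros j _.
  rewrite (sumR_ext d _ (fun _ => 0)), sumR_0; [easy|]. intros k _.
  rewrite (sumR_ext d _ (fun _ => 0)), sumR_0; [easy|]. intros l _. ring.
Qed.

Lemma tinner_sum d m (X : nat -> tensor) B :
  tinner d (fun i j k l => sumR m (fun r => X r i j k l)) B = sumR m (fun r => tinner d (X r) B).
Proof.
  induction m as [|m IH]; simpl; [apply tinner_0|]. now rewrite tinner_plus, IH.
Qed.

Lemma tinner_outer d f1 f2 f3 f4 u1 u2 u3 u4 :
  tinner d (fun i j k l => f1 i * f2 j * f3 k * f4 l) (outer4 u1 u2 u3 u4)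
  = rinner d f1 u1 * rinner d f2 u2 * rinner d f3 u3 * rinner d f4 u4.
Proof.
  unfold tinner, outer4, rinner at 1.
  rewrite !Rmult_assoc, (Rmult_comm (sumR d _)), <- sumR_scal. apply sumR_ext; intros i _.
  unfold rinner at 1.
  replace (sumR d (fun j => f2 j * u2 j) * (rinner d f3 u3 * rinner d f4 u4) * (f1 i * u1 i))
   with ((f1 i * u1 i * (rinner d f3 u3 * rinner d f4 u4)) * sumR d (fun j => f2 j * u2 j)) by ring.
  rewrite <- sumR_scal. apply sumR_ext; intros j _.
  unfold rinner at 1.
  replace (f1 i * u1 i * (sumR d (fun k => f3 k * u3 k) * rinner d f4 u4) * (f2 j * u2 j))
   with ((f1 i * u1 i * (f2 j * u2 j) * rinner d f4 u4) * sumR d (fun k => f3 k * u3 k)) by ring.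
  rewrite <- sumR_scal. apply sumR_ext; intros k _.
  unfold rinner.
  replace (f1 i * u1 i * (f2 j * u2 j) * sumR d (fun l => f4 l * u4 l) * (f3 k * u3 k))
   with ((f1 i * u1 i * (f2 j * u2 j) * (f3 k * u3 k)) * sumR d (fun l => f4 l * u4 l)) by ring.
  rewrite <- sumR_scal. apply sumR_ext; intros l _. ring.
Qed.

Definition form_S d (u1 u2 u3 u4 : nat -> R) : R :=
  rinner d u1 u2 * rinner d u3 u4 + rinner d u1 u3 * rinner d u2 u4
  + rinner d u1 u4 * rinner d u2 u3.

Lemma ind_and b1 b2 : Defs.ind (b1 && b2) = Defs.ind b1 * Defs.ind b2.
Proof. destruct b1, b2; unfold Defs.ind; simpl; ring. Qed.

Lemma tinner_S d u1 u2 u3 u4 :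
  tinner d tensS (outer4 u1 u2 u3 u4) = form_S d u1 u2 u3 u4.
Proof.
  unfold tensS. rewrite !tinner_plus. unfold form_S. f_equal; [f_equal|].
  - unfold tinner, outer4, rinner at 1.
    rewrite Rmult_comm, <- sumR_scal. apply sumR_ext; intros i Hi.
    rewrite (sumR_ext d _ (fun j => Defs.ind (Nat.eqb i j) * (u1 i * u2 j * rinner d u3 u4))).
    + rewrite (sumR_delta d i (fun j => u1 i * u2 j * rinner d u3 u4)) by easy. ring.
    + intros j Hj. unfold rinner. rewrite <- !sumR_scal. apply sumR_ext; intros k Hk.
      rewrite (sumR_ext d _ (fun l => Defs.ind (Nat.eqb k l) *
        (Defs.ind (Nat.eqb i j) * (u1 i * u2 j * u3 k) * u4 l))).
      * rewrite (sumR_delta d k (fun l => Defs.ind (Nat.eqb i j) * (u1 i * u2 j * u3 k) * u4 l)) by easy.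
        ring.
      * intros. rewrite ind_and. ring.
  - unfold tinner, outer4, rinner at 1.
    rewrite Rmult_comm, <- sumR_scal. apply sumR_ext; intros i Hi.
    rewrite Rmult_comm. unfold rinner. rewrite <- sumR_scal. apply sumR_ext; intros j Hj.
    rewrite (sumR_ext d _ (fun k => Defs.ind (Nat.eqb i k) * (u1 i * u2 j * u3 k * u4 j))).
    + rewrite (sumR_delta d i (fun k => u1 i * u2 j * u3 k * u4 j)) by easy. ring.
    + intros k Hk.
      rewrite (sumR_ext d _ (fun l => Defs.ind (Nat.eqb j l) *
        (Defs.ind (Nat.eqb i k) * (u1 i * u2 j * u3 k) * u4 l))).
      * rewrite (sumR_delta d j (fun l => Defs.ind (Nat.eqb i k) * (u1 i * u2 j * u3 k) * u4 l)) by easy.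
        ring.
      * intros. rewrite ind_and. ring.
  - unfold tinner, outer4, rinner at 1.
    rewrite Rmult_comm, <- sumR_scal. apply sumR_ext; intros i Hi.
    rewrite Rmult_comm. unfold rinner. rewrite <- sumR_scal. apply sumR_ext; intros j Hj.
    rewrite (sumR_ext d _ (fun k => Defs.ind (Nat.eqb j k) * (u1 i * u2 j * u3 k * u4 i))).
    + rewrite (sumR_delta d j (fun k => u1 i * u2 j * u3 k * u4 i)) by easy. ring.
    + intros k Hk.
      rewrite (sumR_ext d _ (fun l => Defs.ind (Nat.eqb i l) *
        (Defs.ind (Nat.eqb j k) * (u1 i * u2 j * u3 k) * u4 l))).
      * rewrite (sumR_delta d i (fun l => Defs.ind (Nat.eqb j k) * (u1 i * u2 j * u3 k) * u4 l)) by easy.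
        ring.
      * intros. rewrite ind_and. ring.
Qed.

Lemma tinner_outer_null d X u1 u2 u3 u4 :
  rnorm d u1 * rnorm d u2 * rnorm d u3 * rnorm d u4 = 0 ->
  tinner d X (outer4 u1 u2 u3 u4) = 0.
Proof.
  intros H. rewrite <- (tinner_0 d (outer4 u1 u2 u3 u4)). apply tinner_ext.
  intros i j k l Hi Hj Hk Hl. unfold outer4.
  assert (Hz : forall u, rnorm d u = 0 -> forall r, (r < d)%nat -> u r = 0).
  { intros u Hu r Hr. apply (rinner_eq0 d); [|easy]. rewrite <- rnorm_sq, Hu. ring. }
  apply Rmult_integral in H. destruct H as [H|H]; [|rewrite (Hz u4 H l Hl); ring].
  apply Rmult_integral in H. destruct H as [H|H]; [|rewrite (Hz u3 H k Hk); ring].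
  apply Rmult_integral in H. destruct H as [H|H]; [|rewrite (Hz u2 H j Hj); ring].
  rewrite (Hz u1 H i Hi). ring.
Qed.

(** By homogeneity: scaling [u1] by [1 / K] or [- 1 / K] makes the product of norms [1], and the two
    signs give the absolute value. If [K = 0], one vector is null and so is the pairing. *)
Lemma opnorm_le d X delta u1 u2 u3 u4 :
  Rbar_le (opnorm d X) (Finite delta) ->
  Rabs (tinner d X (outer4 u1 u2 u3 u4))
  <= delta * (rnorm d u1 * rnorm d u2 * rnorm d u3 * rnorm d u4).
Proof.
  intros Hop. set (K := rnorm d u1 * rnorm d u2 * rnorm d u3 * rnorm d u4).
  assert (HK : 0 <= K) by (unfold K; repeat apply Rmult_le_pos; apply rnorm_pos).
  destruct (Req_dec K 0) as [H0|H0].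
  { rewrite tinner_outer_null by easy. rewrite H0, Rabs_R0. lra. }
  assert (Hone : forall c, Rabs c = / K -> c * tinner d X (outer4 u1 u2 u3 u4) <= delta).
  { intros c Hc.
    destruct (Lub_Rbar_correct (fun r => exists v1 v2 v3 v4 : nat -> R,
      rnorm d v1 * rnorm d v2 * rnorm d v3 * rnorm d v4 = 1 /\
      r = tinner d X (outer4 v1 v2 v3 v4))) as [Hub _].
    fold (opnorm d X) in Hub.
    assert (Hle : Rbar_le (Finite (c * tinner d X (outer4 u1 u2 u3 u4))) (opnorm d X)).
    { apply Hub. exists (vscal c u1), u2, u3, u4. split.
      - rewrite rnorm_scal, Hc. rewrite !Rmult_assoc. apply Rmult_eq_reg_l with K; [|easy].
        rewrite <- Rmult_assoc, Rinv_r by easy. unfold K. ring.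
      - unfold tinner. rewrite <- sumR_scal; apply sumR_ext; intros i _.
        rewrite <- sumR_scal; apply sumR_ext; intros j _.
        rewrite <- sumR_scal; apply sumR_ext; intros k _.
        rewrite <- sumR_scal; apply sumR_ext; intros l _. unfold outer4, vscal. ring. }
    exact (Rbar_le_trans _ _ _ Hle Hop). }
  assert (HiK : 0 < / K) by (apply Rinv_0_lt_compat; lra).
  set (t := tinner d X (outer4 u1 u2 u3 u4)) in *.
  assert (H1 : / K * t <= delta) by (apply Hone, Rabs_pos_eq; lra).
  assert (H2 : - / K * t <= delta) by (apply Hone; rewrite Rabs_Ropp, Rabs_pos_eq; lra).
  assert (Ht : t = (/ K * t) * K) by (field; easy).
  apply Rabs_le. rewrite Ht. split; nra.
Qed.

(** * The gradient of the loss *)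

(* The matrix [M] of the paper. *)
Definition rot (n : nat) (v : nat -> R) : nat -> R :=
  fun k => if Nat.ltb k n then - v (n + k)%nat else v (k - n)%nat.

Lemma rinner_split n u v :
  rinner (2 * n) u v
  = sumR n (fun j => u j * v j) + sumR n (fun j => u (n + j)%nat * v (n + j)%nat).
Proof. unfold rinner. replace (2 * n)%nat with (n + n)%nat by lia. apply sumR_app. Qed.

Lemma rot_lo n v j : (j < n)%nat -> rot n v j = - v (n + j)%nat.
Proof. intros H. unfold rot. apply Nat.ltb_lt in H. now rewrite H. Qed.

Lemma rot_hi n v j : rot n v (n + j)%nat = v j.
Proof.
  unfold rot. destruct (Nat.ltb_spec (n + j) n); [lia|]. f_equal. lia.
Qed.

Lemma rinner_rot n u v :
  rinner (2 * n) u (rot n v)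
  = sumR n (fun j => u (n + j)%nat * v j) - sumR n (fun j => u j * v (n + j)%nat).
Proof.
  rewrite rinner_split.
  rewrite (sumR_ext n (fun j => u j * rot n v j) (fun j => (-1) * (u j * v (n + j)%nat)))
    by (intros; rewrite rot_lo by easy; ring).
  rewrite (sumR_ext n (fun j => u (n + j)%nat * _) (fun j => u (n + j)%nat * v j))
    by (intros; rewrite rot_hi; ring).
  rewrite sumR_scal. ring.
Qed.

Lemma rinner_rot_swap n u v : rinner (2 * n) (rot n u) v = - rinner (2 * n) u (rot n v).
Proof.
  rewrite rinner_comm, !rinner_rot.
  rewrite (sumR_ext n (fun j => v (n + j)%nat * u j) (fun j => u j * v (n + j)%nat))
    by (intros; ring).
  rewrite (sumR_ext n (fun j => v j * u (n + j)%nat) (fun j => u (n + j)%nat * v j))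
    by (intros; ring). ring.
Qed.

Lemma rinner_rot_rot n u v : rinner (2 * n) u (rot n (rot n v)) = - rinner (2 * n) u v.
Proof.
  rewrite rinner_rot, rinner_split.
  rewrite (sumR_ext n (fun j => u (n + j)%nat * _) (fun j => (-1) * (u (n + j)%nat * v (n + j)%nat)))
    by (intros; rewrite rot_lo by easy; ring).
  rewrite (sumR_ext n (fun j => u j * _) (fun j => u j * v j))
    by (intros; rewrite rot_hi; ring).
  rewrite sumR_scal. ring.
Qed.

Lemma rinner_rot_self n u : rinner (2 * n) u (rot n u) = 0.
Proof. pose proof (rinner_rot_swap n u u) as H. rewrite rinner_comm in H. lra. Qed.

Lemma rinner_rots n u v : rinner (2 * n) (rot n u) (rot n v) = rinner (2 * n) u v.
Proof. rewrite rinner_rot_swap, rinner_rot_rot. ring. Qed.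

Lemma rnorm_rot n u : rnorm (2 * n) (rot n u) = rnorm (2 * n) u.
Proof. unfold rnorm. now rewrite rinner_rots. Qed.

Lemma rot_sub n u v : rot n (vsub u v) = vsub (rot n u) (rot n v).
Proof.
  apply functional_extensionality; intros k. unfold rot, vsub. destruct (Nat.ltb k n); ring.
Qed.

Lemma rot_add n u v : rot n (vadd u v) = vadd (rot n u) (rot n v).
Proof.
  apply functional_extensionality; intros k. unfold rot, vadd. destruct (Nat.ltb k n); ring.
Qed.

Lemma rot_scal n c u : rot n (vscal c u) = vscal c (rot n u).
Proof.
  apply functional_extensionality; intros k. unfold rot, vscal. destruct (Nat.ltb k n); ring.
Qed.

Lemma Re_sumC n f : Re (sumC n f) = sumR n (fun j => Re (f j)).
Proof. induction n as [|n IH]; [easy|]. cbn [sumC sumR]. now rewrite <- IH. Qed.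

Lemma Im_sumC n f : Im (sumC n f) = sumR n (fun j => Im (f j)).
Proof. induction n as [|n IH]; [easy|]. cbn [sumC sumR]. now rewrite <- IH. Qed.

Lemma sumC_ext n f g : (forall i, (i < n)%nat -> f i = g i) -> sumC n f = sumC n g.
Proof.
  induction n as [|n IH]; intros H; simpl; [easy|].
  rewrite IH by (intros; apply H; lia). now rewrite H by lia.
Qed.

Lemma vplus_lo n v j : (j < n)%nat -> vplus n v j = Re (v j).
Proof. intros H. unfold vplus. apply Nat.ltb_lt in H. now rewrite H. Qed.

Lemma vplus_hi n v j : vplus n v (n + j)%nat = Im (v j).
Proof.
  unfold vplus. destruct (Nat.ltb_spec (n + j) n); [lia|]. do 2 f_equal. lia.
Qed.

(** The second argument is the conjugated one, so [<w, x>] has real part [<w^+, x^+>] and imaginary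
    part [<w^+, M x^+>]. *)
Lemma Cmod_cinner n w x :
  (Cmod (cinner n w (toC n x))) ^ 2
  = rinner (2 * n) (vplus n w) x * rinner (2 * n) (vplus n w) x
    + rinner (2 * n) (vplus n w) (rot n x) * rinner (2 * n) (vplus n w) (rot n x).
Proof.
  assert (Hre : Re (cinner n w (toC n x)) = rinner (2 * n) (vplus n w) x).
  { unfold cinner. rewrite Re_sumC, rinner_split, <- sumR_plus. apply sumR_ext. intros j Hj.
    rewrite vplus_lo, vplus_hi by easy. unfold toC. simpl. unfold Re, Im. ring. }
  assert (Him : Im (cinner n w (toC n x)) = rinner (2 * n) (vplus n w) (rot n x)).
  { unfold cinner. rewrite Im_sumC, rinner_rot.
    rewrite (sumR_ext n (fun j => vplus n w j * _) (fun j => Re (w j) * x (n + j)%nat))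
      by (intros; now rewrite vplus_lo).
    rewrite (sumR_ext n (fun j => vplus n w (n + j)%nat * _) (fun j => Im (w j) * x j))
      by (intros; now rewrite vplus_hi).
    replace (_ - _) with (sumR n (fun j => Im (w j) * x j)
      + (-1) * sumR n (fun j => Re (w j) * x (n + j)%nat)) by ring.
    rewrite <- sumR_scal, <- sumR_plus. apply sumR_ext. intros j Hj.
    unfold toC. simpl. unfold Re, Im. ring. }
  rewrite <- Hre, <- Him. unfold Cmod. rewrite pow2_sqrt.
  - unfold Re, Im. ring.
  - pose proof (pow2_ge_0 (fst (cinner n w (toC n x)))).
    pose proof (pow2_ge_0 (snd (cinner n w (toC n x)))). lra.
Qed.

Lemma is_derive_sumR m (f : nat -> R -> R) (l : nat -> R) x :
  (forall i, (i < m)%nat -> is_derive (f i) x (l i)) ->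
  is_derive (fun t => sumR m (fun i => f i t)) x (sumR m l).
Proof.
  induction m as [|m IH]; intros H; simpl.
  - apply (is_derive_const 0).
  - apply (is_derive_plus (fun t => sumR m (fun i => f i t)) (f m)).
    + apply IH. intros; apply H; lia.
    + apply H; lia.
Qed.

Lemma scale_pos m sigma : (1 <= m)%nat -> 0 < sigma -> 0 < INR m * sigma ^ 4.
Proof.
  intros Hm Hsigma. apply Rmult_lt_0_compat; [apply lt_0_INR; lia|now apply pow_lt].
Qed.

Section PhaseRetrieval.

Variables n m : nat.
Variable a : nat -> nat -> C.
Variable xnat : nat -> C.
Variable sigma : R.

Let d := (2 * n)%nat.
Let F := floss n m a xnat.
Let c := INR m * sigma ^ 4.

Notation "u · v" := (rinner (2 * n) u v) (at level 40).
Notation nm := (rnorm (2 * n)).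
Notation A i := (vplus n (a i)).
Notation M := (rot n).

(* [<A_i u, v>] in the notation of the paper, as [a_i^- . u = - a_i^+ . M u]. *)
Definition meas (i : nat) (u v : nat -> R) : R :=
  (A i · u) * (A i · v) + (A i · M u) * (A i · M v).

Definition signal : nat -> R := vplus n xnat.

Lemma floss_meas x : F x = sumR m (fun i => (meas i x x - meas i signal signal) ^ 2).
Proof.
  unfold F, floss. apply sumR_ext. intros i _. f_equal. unfold yobs, meas.
  rewrite Cmod_cinner. f_equal.
  rewrite <- Cmod_cinner. do 2 f_equal. unfold cinner. apply sumC_ext. intros j Hj.
  do 2 f_equal. unfold toC, signal. rewrite vplus_lo, vplus_hi by easy.
  now destruct (xnat j).
Qed.

Lemma floss_nonneg x : 0 <= F x.
Proof. apply sumR_pos. intros. apply pow2_ge_0. Qed.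

Lemma meas_comm i u v : meas i u v = meas i v u.
Proof. unfold meas. ring. Qed.

Lemma meas_addr i u v w : meas i w (vadd u v) = meas i w u + meas i w v.
Proof. unfold meas. rewrite rot_add. vexp. ring. Qed.

Lemma meas_subr i u v w : meas i w (vsub u v) = meas i w u - meas i w v.
Proof. unfold meas. rewrite rot_sub. vexp. ring. Qed.

Lemma meas_scalr i k u w : meas i w (vscal k u) = k * meas i w u.
Proof. unfold meas. rewrite rot_scal. vexp. ring. Qed.

Lemma meas_addl i u v w : meas i (vadd u v) w = meas i u w + meas i v w.
Proof. rewrite !(meas_comm i _ w). apply meas_addr. Qed.

Lemma meas_subl i u v w : meas i (vsub u v) w = meas i u w - meas i v w.
Proof. rewrite !(meas_comm i _ w). apply meas_subr. Qed.

Lemma meas_scall i k u w : meas i (vscal k u) w = k * meas i u w.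
Proof. rewrite !(meas_comm i _ w). apply meas_scalr. Qed.

(** [circ u (M u) s t] is [u] multiplied by the complex number [s + i t], since [M] is
    multiplication by the imaginary unit. For [s^2 + t^2 = 1] this is phase invariance, the origin
    of the circle of minimizers. *)
Lemma meas_circ i u s t :
  meas i (circ u (M u) s t) (circ u (M u) s t) = (s * s + t * t) * meas i u u.
Proof.
  unfold meas, circ. rewrite rot_add, !rot_scal. vexp. rewrite rinner_rot_rot. ring.
Qed.

Lemma meas_vector i u v :
  meas i u v = vsub (vscal (A i · u) (A i)) (vscal (A i · M u) (M (A i))) · v.
Proof. unfold meas. vexp. rewrite rinner_rot_swap. ring. Qed.

Lemma grad_inner x v :
  grad d F x · v
  = 4 * sumR m (fun i => (meas i x x - meas i signal signal) * meas i x v).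
Proof.
  set (e := fun k j : nat => if Nat.eqb j k then 1 else 0).
  set (w := fun i => vsub (vscal (A i · x) (A i)) (vscal (A i · M x) (M (A i)))).
  set (r := fun i => meas i x x - meas i signal signal).
  assert (Hg : forall k, (k < d)%nat -> grad d F x k = 4 * sumR m (fun i => r i * w i k)).
  { intros k Hk. unfold grad. destruct (Nat.ltb_spec k d); [|lia].
    apply is_derive_unique.
    (* Along a coordinate direction each residual is a quadratic polynomial in [t], so the
       derivative at [0] sees only its constant and linear coefficients. *)
    apply (is_derive_ext (fun t => sumR m (fun i =>
      (r i + 2 * t * meas i x (e k) + t * t * meas i (e k) (e k)) ^ 2))).
    { intros t. change (fun j => x j + t * (if Nat.eqb j k then 1 else 0))
        with (vadd x (vscal t (e k))).
      rewrite floss_meas. apply sumR_ext. intros i _. f_equal.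
      rewrite !meas_addl, !meas_addr, !meas_scall, !meas_scalr, (meas_comm i (e k) x).
      unfold r. ring. }
    rewrite <- sumR_scal. apply is_derive_sumR. intros i _.
    assert (Hw : w i k = meas i x (e k)).
    { rewrite meas_vector. fold (w i). rewrite rinner_comm.
      rewrite <- (sumR_delta d k (w i) Hk). apply sumR_ext. intros j _. unfold e, Defs.ind.
      now rewrite Nat.eqb_sym. }
    rewrite Hw. auto_derive; [easy|]. ring. }
  unfold rinner. rewrite (sumR_ext (2 * n) _ (fun k => 4 * sumR m (fun i => r i * w i k * v k))).
  - rewrite sumR_scal, sumR_swap. f_equal. apply sumR_ext. intros i _.
    rewrite (meas_vector i x v). fold (w i). fold (r i). unfold rinner. rewrite <- sumR_scal.
    apply sumR_ext. intros; ring.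
  - intros k Hk. rewrite Hg by easy. rewrite Rmult_assoc. f_equal.
    rewrite Rmult_comm, <- sumR_scal. apply sumR_ext. intros; ring.
Qed.

Hypothesis Hm : (1 <= m)%nat.
Hypothesis Hsigma : 0 < sigma.
Hypothesis Hop : Rbar_le (opnorm (2 * n) (tsub (tensT n m a sigma) tensS)) (Finite (1 / 1000)).

Definition form_T (u1 u2 u3 u4 : nat -> R) : R :=
  / c * sumR m (fun i => (A i · u1) * (A i · u2) * (A i · u3) * (A i · u4)).

Lemma tinner_T u1 u2 u3 u4 :
  tinner (2 * n) (tensT n m a sigma) (outer4 u1 u2 u3 u4) = form_T u1 u2 u3 u4.
Proof.
  unfold tensT. rewrite tinner_scal, tinner_sum. unfold form_T. f_equal.
  apply sumR_ext. intros i _. apply tinner_outer.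
Qed.

Lemma form_close u1 u2 u3 u4 :
  Rabs (form_T u1 u2 u3 u4 - form_S (2 * n) u1 u2 u3 u4)
  <= 1 / 1000 * (nm u1 * nm u2 * nm u3 * nm u4).
Proof.
  rewrite <- tinner_T, <- tinner_S, <- tinner_sub. now apply opnorm_le.
Qed.

(* [quad_S] is the value of [quad_T] if [T = S]. *)
Definition quad_T (x y u v : nat -> R) : R := / c * sumR m (fun i => meas i x y * meas i u v).

Definition quad_S (x y u v : nat -> R) : R :=
  4 * (x · y) * (u · v) + 2 * ((x · u) * (y · v) + (x · M u) * (y · M v))
  + 2 * ((x · v) * (y · u) + (x · M v) * (y · M u)).

Lemma quad_T_forms x y u v :
  quad_T x y u v
  = form_T x y u v + form_T (M x) (M y) u v + form_T x y (M u) (M v)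
    + form_T (M x) (M y) (M u) (M v).
Proof.
  unfold quad_T, form_T. rewrite <- !Rmult_plus_distr_l, <- !sumR_plus. f_equal.
  apply sumR_ext. intros i _. unfold meas. ring.
Qed.

Lemma quad_S_forms x y u v :
  quad_S x y u v
  = form_S (2 * n) x y u v + form_S (2 * n) (M x) (M y) u v + form_S (2 * n) x y (M u) (M v)
    + form_S (2 * n) (M x) (M y) (M u) (M v).
Proof.
  unfold quad_S, form_S. rewrite !rinner_rots, !(rinner_rot_swap n). ring.
Qed.

(** Each of the four forms contributes [1 / 1000], as [M] preserves norms. *)
Lemma quad_close x y u v :
  Rabs (quad_T x y u v - quad_S x y u v) <= 4 / 1000 * (nm x * nm y * nm u * nm v).
Proof.
  rewrite quad_T_forms, quad_S_forms.
  pose proof (form_close x y u v) as H1. pose proof (form_close (M x) (M y) u v) as H2.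
  pose proof (form_close x y (M u) (M v)) as H3.
  pose proof (form_close (M x) (M y) (M u) (M v)) as H4.
  rewrite !rnorm_rot in *. apply Rabs_le_between in H1, H2, H3, H4. apply Rabs_le. lra.
Qed.

Lemma quad_S_bound x y u v : Rabs (quad_S x y u v) <= 12 * (nm x * nm y * nm u * nm v).
Proof.
  assert (Hp : forall s t s' t', Rabs ((s · t) * (s' · t')) <= nm s * nm t * (nm s' * nm t')).
  { intros. rewrite Rabs_mult. apply Rmult_le_compat; try apply Rabs_pos; apply cauchy_schwarz. }
  unfold quad_S.
  pose proof (Hp x y u v) as H1. pose proof (Hp x u y v) as H2.
  pose proof (Hp x (M u) y (M v)) as H3. pose proof (Hp x v y u) as H4.
  pose proof (Hp x (M v) y (M u)) as H5. rewrite !rnorm_rot in *.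
  apply Rabs_le_between in H1, H2, H3, H4, H5. apply Rabs_le. split; nra.
Qed.

Lemma quad_T_bound x y u v : Rabs (quad_T x y u v) <= 13 * (nm x * nm y * nm u * nm v).
Proof.
  pose proof (quad_close x y u v) as H1. pose proof (quad_S_bound x y u v) as H2.
  assert (0 <= nm x * nm y * nm u * nm v) by (repeat apply Rmult_le_pos; apply rnorm_pos).
  apply Rabs_le_between in H1, H2. apply Rabs_le. lra.
Qed.

Definition multi_sub (B : (nat -> R) -> (nat -> R) -> (nat -> R) -> (nat -> R) -> R) : Prop :=
  (forall x x' y u v, B (vsub x x') y u v = B x y u v - B x' y u v) /\
  (forall x y y' u v, B x (vsub y y') u v = B x y u v - B x y' u v) /\
  (forall x y u u' v, B x y (vsub u u') v = B x y u v - B x y u' v).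

Lemma quad_T_multi : multi_sub quad_T.
Proof.
  unfold multi_sub, quad_T. repeat split; intros; rewrite <- Rmult_minus_distr_l; f_equal;
  rewrite <- (Rplus_0_r (sumR m _)); symmetry; rewrite <- (Rplus_0_r (_ - _));
  match goal with |- sumR m ?f - sumR m ?g + 0 = sumR m ?h + 0 =>
    replace (sumR m f - sumR m g) with (sumR m f + (-1) * sumR m g) by ring;
    rewrite <- sumR_scal, <- sumR_plus; f_equal; apply sumR_ext; intros i _ end;
  rewrite ?meas_subl, ?meas_subr; ring.
Qed.

Lemma quad_S_multi : multi_sub quad_S.
Proof.
  unfold multi_sub, quad_S. repeat split; intros; rewrite ?rot_sub; vexp; ring.
Qed.

Lemma quad_diff_multi : multi_sub (fun x y u v => quad_T x y u v - quad_S x y u v).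
Proof.
  destruct quad_T_multi as (H1 & H2 & H3). destruct quad_S_multi as (H1' & H2' & H3').
  repeat split; intros; rewrite ?H1, ?H2, ?H3, ?H1', ?H2', ?H3'; ring.
Qed.

(** Replacing [P] by [Q] one slot at a time gives three terms, each with two factors bounded by [r];
    the term with [z] gives the [1]. *)
Lemma multi_lipschitz B K z r P Q v :
  multi_sub B -> 0 <= K -> (forall x y u v, Rabs (B x y u v) <= K * (nm x * nm y * nm u * nm v)) ->
  nm z = 1 -> nm P <= r -> nm Q <= r ->
  Rabs ((B P P P v - B z z P v) - (B Q Q Q v - B z z Q v))
  <= K * (3 * (r * r) + 1) * nm (vsub P Q) * nm v.
Proof.
  intros (H1 & H2 & H3) HK HB Hz HP HQ.
  pose proof (rnorm_pos (2 * n) P) as HP0. pose proof (rnorm_pos (2 * n) Q) as HQ0.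
  pose proof (rnorm_pos (2 * n) (vsub P Q)) as HD0. pose proof (rnorm_pos (2 * n) v) as Hv0.
  replace (_ - _) with (B (vsub P Q) P P v + B Q (vsub P Q) P v + B Q Q (vsub P Q) v
    - B z z (vsub P Q) v) by (rewrite H1, H2, !H3; ring).
  pose proof (HB (vsub P Q) P P v) as G1. pose proof (HB Q (vsub P Q) P v) as G2.
  pose proof (HB Q Q (vsub P Q) v) as G3. pose proof (HB z z (vsub P Q) v) as G4.
  rewrite Hz in G4. apply Rabs_le_between in G1, G2, G3, G4.
  set (D := nm (vsub P Q)) in *. set (V := nm v) in *. set (p := nm P) in *. set (q := nm Q) in *.
  assert (HDV : 0 <= K * (D * V)) by (repeat apply Rmult_le_pos; easy).
  assert (E1 : K * (D * p * p * V) <= K * (D * V) * (r * r)).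
  { replace (K * (D * p * p * V)) with (K * (D * V) * (p * p)) by ring.
    apply Rmult_le_compat_l; [easy|]. apply Rmult_le_compat; lra. }
  assert (E2 : K * (q * D * p * V) <= K * (D * V) * (r * r)).
  { replace (K * (q * D * p * V)) with (K * (D * V) * (q * p)) by ring.
    apply Rmult_le_compat_l; [easy|]. apply Rmult_le_compat; lra. }
  assert (E3 : K * (q * q * D * V) <= K * (D * V) * (r * r)).
  { replace (K * (q * q * D * V)) with (K * (D * V) * (q * q)) by ring.
    apply Rmult_le_compat_l; [easy|]. apply Rmult_le_compat; lra. }
  replace (K * (3 * (r * r) + 1) * D * V) with
    (3 * (K * (D * V) * (r * r)) + K * (1 * 1 * D * V)) by ring.
  apply Rabs_le. lra.
Qed.

(** * The gradient field rescaled to a unit signal *)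

Section Normalized.

Variable lam : R.
Hypothesis Hlam : 0 < lam.
Variable z : nat -> R.
Hypothesis Hz : z · z = 1.
Hypothesis Hsignal : signal = vscal lam z.

(** The gradient is cubic, jointly in the point and the signal, hence [lam ^ 3]. Of [16 c], the part
    [4 c] turns the sum over measurements into [quad_T], and the other [4] makes the ideal value
    equal to [drift]. *)
Definition ngrad (x : nat -> R) : nat -> R :=
  vscal (/ (16 * c * lam ^ 3)) (grad d F (vscal lam x)).

Lemma ngrad_inner x v : ngrad x · v = / 4 * (quad_T x x x v - quad_T z z x v).
Proof.
  unfold ngrad. rewrite rinner_scall, grad_inner, Hsignal. unfold quad_T.
  pose proof (scale_pos m sigma Hm Hsigma : 0 < c) as Hc.
  replace (/ 4 * _) with (/ (16 * c * lam ^ 3) * (4 * (lam ^ 3 *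
    (sumR m (fun i => meas i x x * meas i x v) + (-1) * sumR m (fun i => meas i z z * meas i x v)))))
    by (field; split; lra).
  f_equal. f_equal. rewrite <- (sumR_scal m (-1)), <- sumR_plus, <- sumR_scal.
  apply sumR_ext. intros i _. rewrite !meas_scall, !meas_scalr. ring.
Qed.

Lemma drift_inner x v :
  drift (2 * n) z (M z) x · v = / 4 * (quad_S x x x v - quad_S z z x v).
Proof.
  unfold drift, circ, quad_S, normsq, coord_z, coord_y. vexp. rewrite !(rinner_rot_swap n), rinner_rot_self, Hz.
  field.
Qed.

Lemma err_inner x v :
  err (2 * n) z (M z) ngrad x · v
  = / 4 * ((quad_T x x x v - quad_S x x x v) - (quad_T z z x v - quad_S z z x v)).
Proof. unfold err. vexp. rewrite ngrad_inner, drift_inner. ring. Qed.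

Lemma z_norm : nm z = 1.
Proof. unfold rnorm. rewrite Hz. apply sqrt_1. Qed.

(** The factor [/ 4] turns the bounds [4 / 1000] and [13] on the forms into [1 / 1000] and
    [13 / 4 <= 4]. Vanishing on the circle is exact, by [meas_circ]. *)
Lemma ngrad_near_ideal : near_ideal (2 * n) z (M z) ngrad.
Proof.
  pose proof z_norm as Hz1. split.
  - easy.
  - now rewrite rinner_rots.
  - apply rinner_rot_self.
  - intros r P Q Hr HP HQ. apply rnorm_le_of_dual.
    { pose proof (rnorm_pos (2 * n) (vsub P Q)). apply Rmult_le_pos; [nra|easy]. }
    intros v. rewrite rinner_subl, !err_inner, <- Rmult_minus_distr_l, Rabs_mult.
    rewrite (Rabs_pos_eq (/ 4)) by lra.
    pose proof (multi_lipschitz _ (4 / 1000) z r P Q v quad_diff_multi ltac:(lra)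
      quad_close Hz1 HP HQ) as H. lra.
  - intros r P Q Hr HP HQ.
    assert (Hp : 0 <= (3 * (r * r) + 1) * nm (vsub P Q)).
    { pose proof (rnorm_pos (2 * n) (vsub P Q)). apply Rmult_le_pos; [nra|easy]. }
    apply rnorm_le_of_dual; [lra|].
    intros v. rewrite rinner_subl, !ngrad_inner, <- Rmult_minus_distr_l, Rabs_mult.
    rewrite (Rabs_pos_eq (/ 4)) by lra.
    pose proof (multi_lipschitz _ 13 z r P Q v quad_T_multi ltac:(lra)
      quad_T_bound Hz1 HP HQ) as H.
    assert (0 <= (3 * (r * r) + 1) * nm (vsub P Q) * nm v)
      by (apply Rmult_le_pos; [easy|apply rnorm_pos]). lra.
  - apply Rle_antisym; [|apply rnorm_pos]. apply rnorm_le_of_dual; [lra|].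
    intros v. rewrite ngrad_inner.
    pose proof (quad_T_bound vzero vzero vzero v) as H1.
    pose proof (quad_T_bound z z vzero v) as H2. rewrite rnorm_zero in H1, H2.
    apply Rabs_le_between in H1, H2.
    replace (_ - _) with 0 by lra. rewrite Rmult_0_r, Rabs_R0. lra.
  - intros s t Hst. apply Rle_antisym; [|apply rnorm_pos]. apply rnorm_le_of_dual; [lra|].
    intros v. rewrite ngrad_inner.
    replace (quad_T (circ z (M z) s t) (circ z (M z) s t) (circ z (M z) s t) v)
      with (quad_T z z (circ z (M z) s t) v).
    + replace (_ - _) with 0 by ring. rewrite Rmult_0_r, Rabs_R0. lra.
    + unfold quad_T. f_equal. apply sumR_ext. intros i _. rewrite meas_circ, Hst. ring.
Qed.

End Normalized.

End PhaseRetrieval.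

(** * The main theorem *)

Lemma rinner_null d w u : rnorm d u = 0 -> rinner d w u = 0.
Proof.
  intros H. pose proof (cauchy_schwarz2 d w u) as Hc. rewrite H in Hc. lra.
Qed.

(** The loss is here a quartic form, and its gradient pairs with [x] to at least [28 c |x|^4]
    because [quad_S x x x x = 8 |x|^4]. So every starting point converges to [0]. *)
Lemma gd_zero_signal n m a xnat sigma :
  (1 <= m)%nat -> 0 < sigma ->
  Rbar_le (opnorm (2 * n) (tsub (tensT n m a sigma) tensS)) (Finite (1 / 1000)) ->
  rnorm (2 * n) (signal n xnat) = 0 ->
  forall x0, exists abar, 0 < abar /\ forall alpha,
    (forall k, 0 < alpha k <= abar) -> is_lim_seq (fun K => sumR K alpha) p_infty ->
    forall j, (j < 2 * n)%nat ->
      is_lim_seq (fun k => gd (2 * n) (floss n m a xnat) alpha x0 k j) 0.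
Proof.
  intros Hm Hsigma Hop Hsig x0.
  set (c := INR m * sigma ^ 4). assert (Hc : 0 < c) by now apply scale_pos.
  set (d := (2 * n)%nat). set (F := floss n m a xnat). set (q0 := rinner d x0 x0).
  assert (Hq0 : 0 <= q0) by apply rinner_pos.
  assert (HK : 0 < 100 * c * (q0 + 1)) by (apply Rmult_lt_0_compat; lra).
  (* This gives [al c q <= 1 / 100], so the second order term [2704 al^2 c^2 q^3], with
     [2704 = (4 * 13)^2], is at most half of the first order decrease [56 al c q^2]. *)
  exists (1 / (100 * c * (q0 + 1))). split; [apply Rdiv_lt_0_compat; lra|].
  intros al Hal Hdiv. set (X := gd d F al x0).
  assert (Hgrad : forall x v, rinner d (grad d F x) v = 4 * c * quad_T n m a sigma x x x v).
  { intros x v. unfold d, F. rewrite grad_inner. unfold quad_T. fold c.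
    replace (4 * c * _) with (4 * sumR m (fun i => meas n a i x x * meas n a i x v)) by (field; lra).
    f_equal. apply sumR_ext. intros i _.
    replace (meas n a i (signal n xnat) (signal n xnat)) with 0; [ring|].
    unfold meas. rewrite !(rinner_null (2 * n) _ (signal n xnat)) by easy.
    rewrite !(rinner_null (2 * n) _ (rot n (signal n xnat))) by (now rewrite rnorm_rot). ring. }
  assert (Hlow : forall x, 28 * c * (rinner d x x * rinner d x x) <= rinner d (grad d F x) x).
  { intros x. rewrite Hgrad.
    pose proof (quad_close n m a sigma Hop x x x x) as Hq.
    replace (rnorm (2 * n) x * rnorm (2 * n) x * rnorm (2 * n) x * rnorm (2 * n) x)
      with ((rnorm (2 * n) x * rnorm (2 * n) x) * (rnorm (2 * n) x * rnorm (2 * n) x)) in Hq by ring.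
    rewrite rnorm_sq in Hq. unfold quad_S in Hq. rewrite !rinner_rot_self in Hq.
    fold d in Hq. apply Rabs_le_between in Hq.
    assert (0 <= rinner d x x * rinner d x x) by apply Rle_0_sqr.
    replace (28 * c * (rinner d x x * rinner d x x))
      with (4 * c * (7 * (rinner d x x * rinner d x x))) by ring.
    apply Rmult_le_compat_l; lra. }
  assert (Hup : forall x, rinner d (grad d F x) (grad d F x)
      <= 2704 * (c * c) * (rinner d x x * rinner d x x * rinner d x x)).
  { intros x. pose proof (rnorm_pos d x) as Hx.
    assert (Hr3 : 0 <= rnorm d x * rnorm d x * rnorm d x) by (repeat apply Rmult_le_pos; easy).
    assert (H : rnorm d (grad d F x) <= 52 * c * (rnorm d x * rnorm d x * rnorm d x)).
    { apply rnorm_le_of_dual; [nra|]. intros v. rewrite Hgrad.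
      rewrite Rabs_mult, (Rabs_pos_eq (4 * c)) by lra.
      replace (52 * c * (rnorm d x * rnorm d x * rnorm d x) * rnorm d v)
        with (4 * c * (13 * (rnorm d x * rnorm d x * rnorm d x * rnorm d v))) by ring.
      apply Rmult_le_compat_l; [lra|]. now apply quad_T_bound. }
    rewrite <- !rnorm_sq. pose proof (rnorm_pos d (grad d F x)).
    replace (2704 * (c * c) * _) with
      ((52 * c * (rnorm d x * rnorm d x * rnorm d x)) * (52 * c * (rnorm d x * rnorm d x * rnorm d x)))
      by ring.
    now apply Rmult_le_compat. }
  set (Q := fun k => rinner d (X k) (X k)).
  assert (Hstep : forall k, Q k <= q0 -> Q (S k) <= Q k - 28 * c * al k * (Q k * Q k)).
  { intros k Hk. unfold Q at 1.
    change (X (S k)) with (vsub (X k) (vscal (al k) (grad d F (X k)))). vexp.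
    rewrite (rinner_comm d (X k) (grad d F (X k))).
    pose proof (Hlow (X k)) as H1. pose proof (Hup (X k)) as H2. fold (Q k) in H1, H2 |- *.
    assert (Hp : 0 <= Q k) by apply rinner_pos.
    destruct (Hal k) as [Ha1 Ha2]. apply Rle_div_r in Ha2; [|easy].
    set (u := Q k) in *. set (G := rinner d (grad d F (X k)) (X k)) in *.
    set (GG := rinner d (grad d F (X k)) (grad d F (X k))) in *. set (t := al k) in *.
    assert (E1 : t * (28 * c * (u * u)) <= t * G) by (apply Rmult_le_compat_l; lra).
    assert (E2 : t * t * GG <= t * (28 * c * (u * u))).
    { rewrite Rmult_assoc. apply Rmult_le_compat_l; [lra|].
      apply Rle_trans with (t * (2704 * (c * c) * (u * u * u))); [apply Rmult_le_compat_l; lra|].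
      replace (t * (2704 * (c * c) * (u * u * u)))
        with ((2704 * c * (u * u)) * (t * (c * u))) by ring.
      assert (Hcu : t * (c * u) <= / 100).
      { apply Rle_trans with (t * (c * (q0 + 1))); [|lra].
        apply Rmult_le_compat_l; [lra|]. apply Rmult_le_compat_l; lra. }
      assert (0 <= 2704 * c * (u * u)) by (apply Rmult_le_pos; nra).
      apply Rle_trans with (2704 * c * (u * u) * / 100); [now apply Rmult_le_compat_l|].
      lra. }
    lra. }
  assert (HQ0 : forall k, 0 <= Q k) by (intros; apply rinner_pos).
  assert (Hb : forall k, Q k <= q0).
  { induction k as [|k IH]; [apply Rle_refl|]. pose proof (Hstep k IH).
    destruct (Hal k). assert (0 <= 28 * c * al k * (Q k * Q k)).
    { apply Rmult_le_pos; [apply Rmult_le_pos; lra|apply Rle_0_sqr]. } lra. }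
  assert (Hdec : forall k, Q (S k) <= Q k).
  { intros k. pose proof (Hstep k (Hb k)).
    destruct (Hal k). assert (0 <= 28 * c * al k * (Q k * Q k)).
    { apply Rmult_le_pos; [apply Rmult_le_pos; lra|apply Rle_0_sqr]. } lra. }
  destruct (ex_finite_lim_seq_decr Q 0 Hdec HQ0) as [l Hl].
  assert (Hl0 : l = 0).
  { assert (Hle : forall k, l <= Q k) by (apply (is_lim_seq_decr_compare Q l Hl Hdec)).
    assert (Hlp : 0 <= l).
    { apply (is_lim_seq_le (fun _ => 0) Q 0 l); [easy|apply is_lim_seq_const|easy]. }
    destruct (Req_dec l 0) as [|Hne]; [easy|exfalso].
    apply (divergent_increments (fun k => - Q k) al (28 * c * (l * l)) 0); [|easy| |].
    - apply Rmult_lt_0_compat; [lra|]. apply Rmult_lt_0_compat; lra.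
    - intros k. pose proof (HQ0 k). lra.
    - intros k. pose proof (Hstep k (Hb k)) as Hs. destruct (Hal k) as [Ha _].
      pose proof (Hle k).
      assert (28 * c * al k * (l * l) <= 28 * c * al k * (Q k * Q k)).
      { apply Rmult_le_compat_l; [apply Rmult_le_pos; lra|]. apply Rmult_le_compat; lra. }
      lra. }
  subst l. intros j Hj. apply is_lim_seq_spec. intros eps.
  apply is_lim_seq_spec in Hl. destruct (Hl (mkposreal (eps * eps) (Rmult_lt_0_compat _ _ (cond_pos eps) (cond_pos eps)))) as [N HN].
  exists N. intros k Hk. specialize (HN k Hk). simpl in HN.
  rewrite Rminus_0_r, Rabs_pos_eq in HN by apply HQ0. rewrite Rminus_0_r.
  pose proof (rinner_sq_ge d (X k) j Hj) as Hs. fold (Q k) in Hs.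
  pose proof (cond_pos eps). apply Rabs_lt_between. unfold X in Hs |- *.
  set (v := gd d F al x0 k j) in *. split; nra.
Qed.

Lemma gd_normalized n m a xnat sigma lam al x0 :
  (1 <= m)%nat -> 0 < sigma -> 0 < lam ->
  is_orbit (ngrad n m a xnat sigma lam)
    (fun k => 16 * (INR m * sigma ^ 4) * lam ^ 2 * al k)
    (fun k => vscal (/ lam) (gd (2 * n) (floss n m a xnat) al x0 k)).
Proof.
  intros Hm Hsigma Hlam k. apply functional_extensionality. intros j.
  pose proof (scale_pos m sigma Hm Hsigma) as Hc.
  set (c := INR m * sigma ^ 4) in *. cbn [gd].
  unfold ngrad, gstep, vsub, vscal. fold c.
  set (x := gd (2 * n) (floss n m a xnat) al x0 k).
  replace (fun j0 => lam * (/ lam * x j0)) with x.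
  - field. split; lra.
  - apply functional_extensionality. intros i. field. lra.
Qed.

Theorem theorem2 :
  exists delta0 : R, 0 < delta0 /\
  forall (n m : nat) (a : nat -> nat -> C) (xnat : nat -> C) (sigma : R),
    (1 <= n)%nat -> (1 <= m)%nat -> 0 < sigma ->
    Rbar_le (opnorm (2 * n) (tsub (tensT n m a sigma) tensS)) (Finite delta0) ->
    exists E : (nat -> R) -> Prop,
      lebesgue_null (2 * n) E /\
      forall x0 : nat -> R, ~ E x0 ->
        exists abar : R, 0 < abar /\
        forall alpha : nat -> R,
          (forall k, 0 < alpha k <= abar) ->
          is_lim_seq (fun K => sumR K alpha) p_infty ->
          exists xstar : nat -> R,
            (forall z : nat -> R, floss n m a xnat xstar <= floss n m a xnat z) /\
            (forall j, (j < 2 * n)%nat ->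
               is_lim_seq (fun k => gd (2 * n) (floss n m a xnat) alpha x0 k j) (xstar j)).
Proof.
  exists (1 / 1000). split; [lra|].
  intros n m a xnat sigma Hn Hm Hsigma Hop.
  set (lam := rnorm (2 * n) (signal n xnat)).
  destruct (Req_dec lam 0) as [Hlam0|Hlam0].
  { exists (fun _ => False). split.
    - intros eps Heps. exists (fun _ _ => 0), (fun _ _ => 0).
      split; [intros; lra|split; [|easy]].
      intros K. rewrite (sumR_ext K _ (fun _ => 0)), sumR_0; [lra|].
      intros k _. rewrite (prodR_const (2 * n)).
      replace (0 - 0) with 0 by ring. apply pow_i. lia.
    - intros x0 _.
      destruct (gd_zero_signal n m a xnat sigma Hm Hsigma Hop Hlam0 x0) as (abar & Habar & Hconv).
      exists abar. split; [easy|]. intros al Hal Hdiv.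
      exists vzero. split; [|intros j Hj; now apply Hconv].
      intros z. apply Rle_trans with 0; [right|apply floss_nonneg].
      rewrite floss_meas, (sumR_ext m _ (fun _ => 0)), sumR_0; [easy|]. intros i _.
      unfold meas.
      assert (Hv : forall u w, rnorm (2 * n) w = 0 -> rinner (2 * n) u w = 0)
        by (intros; now apply rinner_null).
      rewrite !(Hv _ vzero), !(Hv _ (signal n xnat)) by (easy || apply rnorm_zero).
      rewrite !(Hv _ (rot n _)) by (rewrite rnorm_rot; easy || apply rnorm_zero). ring. }
  assert (Hlam : 0 < lam) by (pose proof (rnorm_pos (2 * n) (signal n xnat)); unfold lam in *; lra).
  set (z := vscal (/ lam) (signal n xnat)).
  assert (Hz : rinner (2 * n) z z = 1).
  { unfold z. vexp. rewrite <- rnorm_sq. fold lam. field. easy. }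
  assert (Hsig : signal n xnat = vscal lam z).
  { apply functional_extensionality. intros j. unfold z, vscal. field. easy. }
  set (g := ngrad n m a xnat sigma lam).
  assert (NI : near_ideal (2 * n) z (rot n z) g) by now apply ngrad_near_ideal.
  set (K := 16 * (INR m * sigma ^ 4) * lam ^ 2).
  assert (HK : 0 < K).
  { pose proof (scale_pos m sigma Hm Hsigma). apply Rmult_lt_0_compat; [lra|now apply pow_lt]. }
  exists (fun x => stuck_point (2 * n) z (rot n z) g (vscal (/ lam) x)). split.
  { apply stuck_null; [easy|lia|easy]. }
  intros x0 Hx0. set (u0 := vscal (/ lam) x0) in *.
  (* The failure of [stuck_point] at [u0] yields one [eta] that serves all step sequences. *)
  assert (Heta : exists eta, 0 < eta /\ forall al x, is_orbit g al x -> x O = u0 ->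
    (forall k, 0 < al k <= eta) -> is_lim_seq (fun K => sumR K al) p_infty ->
    ~ stuck (2 * n) z (rot n z) x).
  { apply NNPP. intros Hno. apply Hx0. intros eta He. apply NNPP. intros Hno2. apply Hno.
    exists eta. split; [easy|]. intros al x H1 H2 H3 H4 H5. apply Hno2. now exists al, x. }
  destruct Heta as (eta & Heta & Hun).
  destruct (small_step_exists 2 ltac:(lra)) as (A & HA & HsA).
  assert (Hmin : 0 < Rmin eta A) by now apply Rmin_glb_lt.
  (* [K] converts the steps of the descent into those of the normalised orbit. The bound for
     [small_step 2] serves even a distant starting point, because an orbit that is not stuck has a
     time with [q <= 2], and the argument starts there. *)
  exists (Rmin eta A / K). split; [now apply Rdiv_lt_0_compat|].
  intros al Hal Hdiv.
  pose proof (gd_normalized n m a xnat sigma lam al x0 Hm Hsigma Hlam) as Horb.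
  fold K in Horb. fold g in Horb.
  set (x := fun k => vscal (/ lam) (gd (2 * n) (floss n m a xnat) al x0 k)) in Horb.
  assert (Hbe : forall k, 0 < K * al k <= Rmin eta A).
  { intros k. destruct (Hal k) as [H1 H2]. apply Rle_div_r in H2; [|easy]. split; [nra|lra]. }
  assert (Hdiv' : is_lim_seq (fun k => sumR k (fun i => K * al i)) p_infty).
  { apply (is_lim_seq_ext (fun k => K * sumR k al)); [intros; now rewrite sumR_scal|].
    replace p_infty with (Rbar_mult K p_infty).
    - now apply is_lim_seq_scal_l.
    - apply is_Rbar_mult_unique, (is_Rbar_mult_p_infty_pos K). easy. }
  assert (Hns : ~ stuck (2 * n) z (rot n z) x).
  { apply (Hun (fun k => K * al k) x Horb eq_refl); [|easy].
    intros k. pose proof (Hbe k). pose proof (Rmin_l eta A). lra. }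
  apply not_all_ex_not in Hns. destruct Hns as [k0 Hk0].
  apply imply_to_and in Hk0. destruct Hk0 as [Hk1 Hk2]. apply Rnot_le_lt in Hk2.
  destruct (unstuck_converges _ _ _ _ NI (fun k => K * al k) x k0 Horb) as (s & t & Hst & Hlim); try easy.
  { intros k. apply HsA. pose proof (Hbe k). pose proof (Rmin_r eta A). lra. }
  exists (vscal lam (circ z (rot n z) s t)). split.
  - intros w. apply Rle_trans with 0; [right|apply floss_nonneg].
    rewrite floss_meas, (sumR_ext m _ (fun _ => 0)), sumR_0; [easy|]. intros i _.
    rewrite Hsig, !meas_scall, !meas_scalr, meas_circ, Hst. ring.
  - intros j Hj. specialize (Hlim j Hj).
    apply (is_lim_seq_ext (fun k => lam * x k j)).
    + intros k. unfold x, vscal. field. easy.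
    + now apply (is_lim_seq_scal_l (fun k => x k j) lam (circ z (rot n z) s t j)).
Qed.
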